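(* Let $N\ge 1$, let $\Xi$ be a standard normally distributed random $N$-vector, let $\{\Xi_{n,k}\}_{n\ge1,\,1\le k\le n}$ be an $N$-STA with row sums $\Sigma_n=\sum_{k=1}^n\Xi_{n,k}$, and let $\{\Xi^0_{n,k}\}$ be an independent copy of $\{\Xi_{n,k}\}$. Then $$\lambda(\Sigma_n\to\Xi)\le 2\Big(L(\{\Xi_{n,k}\},\{\Xi_{n,k}\})+L(\{\Xi_{n,k}\},\{\Xi^0_{n,k}\})\Big).$$ In particular, for every $t\in\mathbb{R}^N$, $$\limsup_{n\to\infty}\left|\phi_\Xi(t)-\phi_{\Sigma_n}(t)\right|\le 2\left(1-\exp\left(-\tfrac12|t|^2\right)\right)\Big(L(\{\Xi_{n,k}\},\{\Xi_{n,k}\})+L(\{\Xi_{n,k}\},\{\Xi^0_{n,k}\})\Big).$$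
   Context: $|\cdot|$ and $\langle\cdot,\cdot\rangle$ are the Euclidean norm and inner product on $\mathbb{R}^N$. A random $N$-vector is an $\mathbb{R}^N$-valued random variable. An $N$-dimensional standard triangular array ($N$-STA) is a triangular array $\{\Xi_{n,k}\}_{n\ge1,\,1\le k\le n}$ of random $N$-vectors such that: (1) for every $n$, $\Xi_{n,1},\dots,\Xi_{n,n}$ are independent; (2) $\mathbb{E}[\Xi_{n,k}]=0$ for all $n,k$; (3) for every $n$, $\mathrm{cov}(\Sigma_n)=I_{N\times N}$ where $\Sigma_n=\sum_{k=1}^n\Xi_{n,k}$. An independent copy of $\{\Xi_{n,k}\}$ is an array with the same law as, and independent of, $\{\Xi_{n,k}\}$. Fourier transform of a random $N$-vector $H$: $\phi_H(t)=\mathbb{E}[\exp(-i\langle t,H\rangle)]$, $t\in\mathbb{R}^N$. Limit operator: $\lambda(\Sigma_n\to\Xi)=\sup_{t\in\mathbb{R}^N}\limsup_{n\to\infty}|\phi_\Xi(t)-\phi_{\Sigma_n}(t)|$. For $N$-STA's $\{\Xi_{n,k}\}$, $\{H_{n,k}\}$: $L(\{\Xi_{n,k}\},\{H_{n,k}\})=\sup_{t\in\mathbb{R}^N}\limsup_{n\to\infty}\sum_{k=1}^n\mathbb{E}\big[|\Xi_{n,k}|^2;\,|\langle H_{n,k},t\rangle|>1\big]$, where $\mathbb{E}[X;A]=\mathbb{E}[X\mathbf 1_A]$. *)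

(* Defs.v *)
From HB Require Import structures.
From mathcomp Require Import all_boot all_order all_algebra finmap.
From mathcomp Require Import all_classical all_reals all_analysis.
From mathcomp Require Export complex.
Export numFieldNormedType.Exports.

Set Implicit Arguments.
Unset Strict Implicit.
Unset Printing Implicit Defensive.

Import Order.TTheory GRing.Theory Num.Theory.

Local Open Scope classical_set_scope.
Local Open Scope ring_scope.
Local Open Scope complex_scope.

(* The sigma-algebra on 'rV[T]_n is the product one, as the library does for
   n.-tuple T; for T = R it is the Borel sigma-algebra of R^n. *)
Definition measure_rV_display : measure_display -> measure_display.
Proof. exact. Qed.

Section measurable_rV.
Context {d} {T : measurableType d}.
Variable n : nat.

Let coors : 'I_n -> 'rV[T]_n -> T := fun i x => x ord0 i.

Let rV_set0 : g_sigma_preimage coors set0.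
Proof. exact: sigma_algebra0. Qed.

Let rV_setC A : g_sigma_preimage coors A -> g_sigma_preimage coors (~` A).
Proof. exact: sigma_algebraC. Qed.

Let rV_bigcup (F : _^nat) : (forall i, g_sigma_preimage coors (F i)) ->
  g_sigma_preimage coors (\bigcup_i (F i)).
Proof. exact: sigma_algebra_bigcup. Qed.

HB.instance Definition _ := @isMeasurable.Build (measure_rV_display d)
  'rV[T]_n (g_sigma_preimage coors) rV_set0 rV_setC rV_bigcup.

End measurable_rV.

(* The library norm on 'rV[R]_N is the sup norm, hence the explicit Euclidean
   structure. *)
Definition dotv (R : realType) (N : nat) (x y : 'rV[R]_N) : R :=
  \sum_(i < N) x ord0 i * y ord0 i.

Definition enorm (R : realType) (N : nat) (x : 'rV[R]_N) : R :=
  Num.sqrt (dotv x x).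

Definition mutually_independent d d' (T : measurableType d)
    (T' : measurableType d') (R : realType) (P : probability T R)
    (I : choiceType) (X : I -> T -> T') : Prop :=
  forall (J : {fset I}) (A : I -> set T'),
    (forall i, i \in J -> measurable (A i)) ->
    P (\bigcap_(i in [set` J]) (X i @^-1` A i)) =
    (\prod_(i <- J) P (X i @^-1` A i))%E.

Definition standard_normal d (T : measurableType d) (R : realType)
    (P : probability T R) (N : nat) (X : {RV P >-> 'rV[R]_N}) : Prop :=
  mutually_independent P (fun (i : 'I_N) w => X w ord0 i) /\
  forall (i : 'I_N) (A : set R), measurable A ->
    P ((fun w => X w ord0 i) @^-1` A) = normal_prob 0 1 A.

(* Row n has the n entries indexed by 'I_n, so the paper's k is k.+1 here; row 0
   is empty. *)
Definition triangular_array d (T : measurableType d) (R : realType)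
    (P : probability T R) (N : nat) : Type :=
  forall n : nat, 'I_n -> {RV P >-> 'rV[R]_N}.

Definition row_sum d (T : measurableType d) (R : realType)
    (P : probability T R) (N : nat) (X : triangular_array P N) (n : nat)
    (w : T) : 'rV[R]_N :=
  \sum_(k < n) X n k w.

(* No separate integrability clause is needed: expectations are Lebesgue
   integrals in \bar R with +oo - +oo = -oo, so a measurable function whose
   expectation is finite is integrable. *)
Record standard_triangular_array d (T : measurableType d) (R : realType)
    (P : probability T R) (N : nat) (X : triangular_array P N) : Prop := {
  sta_independent : forall n, mutually_independent P (fun k : 'I_n => X n k) ;
  sta_centered : forall n (k : 'I_n) (i : 'I_N),
    ('E_P[fun w => X n k w ord0 i] = 0)%E ;
  sta_covariance : forall n, (0 < n)%N -> forall i j : 'I_N,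
    covariance P (fun w => row_sum X n w ord0 i)
                 (fun w => row_sum X n w ord0 j)
    = ((1%:M : 'M[R]_N) i j)%:E
}.

(* The product sigma-algebra on the space of triangular arrays of vectors. *)
Definition array_measurable (R : realType) (N : nat) :
    set (set (forall n : nat, 'I_n -> 'rV[R]_N)) :=
  <<s [set A | exists n (k : 'I_n) (B : set 'rV[R]_N),
         measurable B /\ A = (fun x => x n k) @^-1` B] >>.

Definition sample_array d (T : measurableType d) (R : realType)
    (P : probability T R) (N : nat) (X : triangular_array P N) (w : T) :
    forall n : nat, 'I_n -> 'rV[R]_N :=
  fun n k => X n k w.

Definition independent_copy d (T : measurableType d) (R : realType)
    (P : probability T R) (N : nat) (X Y : triangular_array P N) : Prop :=
  (forall A, array_measurable A ->
     P (sample_array Y @^-1` A) = P (sample_array X @^-1` A)) /\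
  (forall A B, array_measurable A -> array_measurable B ->
     P (sample_array X @^-1` A `&` sample_array Y @^-1` B) =
     (P (sample_array X @^-1` A) * P (sample_array Y @^-1` B))%E).

Definition expC (R : realType) (z : R[i]) : R[i] :=
  (expR (complex.Re z))%:C * (cos (complex.Im z) +i* sin (complex.Im z)).

Definition expectationC d (T : measurableType d) (R : realType)
    (P : probability T R) (Z : T -> R[i]) : R[i] :=
  fine 'E_P[fun w => complex.Re (Z w)] +i* fine 'E_P[fun w => complex.Im (Z w)].

Definition fourier d (T : measurableType d) (R : realType)
    (P : probability T R) (N : nat) (H : T -> 'rV[R]_N) (t : 'rV[R]_N) : R[i] :=
  expectationC P (fun w => expC (- 'i%C * (dotv t (H w))%:C)).

Definition limsup_fourier_dist d d' (T : measurableType d)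
    (T' : measurableType d') (R : realType) (P : probability T R)
    (P' : probability T' R) (N : nat) (S : nat -> T -> 'rV[R]_N)
    (Z : T' -> 'rV[R]_N) (t : 'rV[R]_N) : \bar R :=
  limn_esup (fun n => (Normc.normc (fourier P' Z t - fourier P (S n) t))%:E).

Definition limit_op d d' (T : measurableType d)
    (T' : measurableType d') (R : realType) (P : probability T R)
    (P' : probability T' R) (N : nat) (S : nat -> T -> 'rV[R]_N)
    (Z : T' -> 'rV[R]_N) : \bar R :=
  ereal_sup (range (limsup_fourier_dist P P' S Z)).

(* E[X; A] *)
Definition expectation_on d (T : measurableType d) (R : realType)
    (P : probability T R) (X : T -> R) (A : set T) : \bar R :=
  'E_P[X * \1_A]%E.

Definition lindeberg d (T : measurableType d) (R : realType)
    (P : probability T R) (N : nat) (X H : triangular_array P N) : \bar R :=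
  ereal_sup (range (fun t : 'rV[R]_N =>
    limn_esup (fun n => \sum_(k < n)
      expectation_on P (fun w => enorm (X n k w) ^+ 2)%R
        [set w | (1 < `|dotv (H n k w) t|)%R])%E)).

(* Main.v *)
(* Write W = <t, S_n> as the sum of Y_k = <t, X_k> and let tau^2 = |t|^2 be its
   variance. For every phase th, the function D s = E cos (s W + th) satisfies
     D' s + s tau^2 D s
       = sum_k (s E[Y_k^2] E[cos (s W + th)] - E[Y_k sin (s W + th)]),
   and since Y_k is independent of W - Y_k, each summand is an average over
   phases b of the Stein residuals
     s E[Y_k^2] E[cos (s Y_k + b)] - E[Y_k sin (s Y_k + b)].
   If the residuals sum up to at most K s tau^2, integrating exp (s^2 tau^2 / 2) D
   over [0, 1] gives
     |E cos (W + th) - cos th exp (- tau^2 / 2)| <= K (1 - exp (- tau^2 / 2)).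
   For the array, cutting at |Y_k| > eps bounds the residuals by the Lindeberg
   sums, the independent copy entering through
     E[|X_k|^2] P(|Y_k| > eps) = E[|X_k|^2; |<X0_k, t>| > eps].
   For the Gaussian vector the residuals vanish by Stein's identity, so the same
   inequality with K = 0 computes its Fourier transform. *)

From HB Require Import structures.
Require Import Defs.
From mathcomp Require Import all_boot all_order all_algebra finmap.
From mathcomp Require Import all_classical all_reals all_analysis measurable_realfun.
From mathcomp Require Import ring lra.

Set Implicit Arguments.
Unset Strict Implicit.
Unset Printing Implicit Defensive.

Import Order.TTheory GRing.Theory Num.Theory.

Local Open Scope classical_set_scope.
Local Open Scope ring_scope.

(** * Trigonometric bounds *)

Section trigonometric_bounds.
Variable R : realType.
Implicit Types x y b : R.

(** Stated for [x] and [y] in either order. The intermediate point is located only by its distance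
    to [x], which is all that the Taylor bounds need. *)
Lemma mean_value (f df : R -> R) x y : (forall z : R, is_derive z 1 f (df z)) ->
  exists2 c, `|c - x| <= `|y - x| & f y - f x = df c * (y - x).
Proof.
move=> fdf.
have cf : continuous f.
  by move=> z; apply/differentiable_continuous/derivable1_diffP; have [] := fdf z.
have main (u v : R) : u <= v -> exists2 c, u <= c <= v &
    f v - f u = df c * (v - u).
  move=> uv.
  have [c] := MVT_segment uv (fun z _ => fdf z) (continuous_subspaceT cf).
  by rewrite in_itv/= => cuv e; exists c.
have [xy|/ltW yx] := leP x y.
  have [c /andP[? ?] e] := main _ _ xy; exists c => //.
  by rewrite !ger0_norm ?subr_ge0// lerD2r.
have [c /andP[? ?] e] := main _ _ yx; exists c.
  by rewrite !ler0_norm ?subr_le0//; lra.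
lra.
Qed.

Lemma ler_dist_cos x y : `|cos x - cos y| <= `|x - y|.
Proof.
have [c _ ->] := @mean_value cos (fun z => - sin z) y x (@is_derive_cos R).
by rewrite normrM normrN ler_piMl// sin_max.
Qed.

(** The Taylor remainder of [sin] at [b] is an increment of [cos] times [x]. Bounding this increment
    by [|x|] or by 2 gives the two estimates below: the quadratic one for small summands, the linear
    one for the tails. *)
Let sinB x b : exists2 c, `|c| <= `|x| &
  sin (x + b) - sin b - x * cos b = (cos (c + b) - cos b) * x.
Proof.
have [c] := @mean_value sin cos b (x + b) (@is_derive_sin R).
rewrite addrK => cx e; exists (c - b) => //; rewrite subrK e; ring.
Qed.

Lemma sin_taylor1 x b : `|sin (x + b) - sin b - x * cos b| <= x ^+ 2.
Proof.
have [c cx ->] := sinB x b; rewrite normrM.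
rewrite -real_normK ?num_real// expr2 ler_wpM2r//.
by rewrite (le_trans (ler_dist_cos _ _))// addrK.
Qed.

Lemma cosB_le2 x y : `|cos x - cos y| <= 2.
Proof. by rewrite (le_trans (ler_normB _ _))// -[leRHS]/(1 + 1) lerD// cos_max. Qed.

Lemma sin_taylor1_le2 x b : `|sin (x + b) - sin b - x * cos b| <= 2 * `|x|.
Proof. by have [c cx ->] := sinB x b; rewrite normrM ler_wpM2r// cosB_le2. Qed.

End trigonometric_bounds.

(** * Expectations of real random variables *)

Section expectation.
Context d (T : measurableType d) (R : realType) (P : probability T R).
Implicit Types f g : T -> R.

Definition L1 f := P.-integrable setT (EFin \o f).

(** The Bochner-style real integral is [fine] of the extended one, so an infinite expectation would
    read as 0; hence the [L1] hypotheses of most lemmas below. *)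
Definition Ex f : R := \int[P]_w f w.

Lemma L1_measurable f : L1 f -> measurable_fun setT f.
Proof. by move=> /integrableP[/measurable_EFinP]. Qed.

Lemma le_L1 f g : measurable_fun setT f -> (forall w, `|f w| <= g w) ->
  L1 g -> L1 f.
Proof.
move=> mf fg; apply: le_integrable => //; first exact/measurable_EFinP.
by move=> w _; rewrite lee_fin (le_trans (fg w))// ler_norm.
Qed.

Lemma L1_cst c : L1 (fun=> c).
Proof. exact: finite_measure_integrable_cst. Qed.

Lemma L1_bounded f c : measurable_fun setT f -> (forall w, `|f w| <= c) -> L1 f.
Proof. by move=> mf fc; apply: (le_L1 mf fc); exact: L1_cst. Qed.

Lemma L1D f g : L1 f -> L1 g -> L1 (fun w => f w + g w).
Proof. by move=> If Ig; exact: (integrableD measurableT If Ig). Qed.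

Lemma L1B f g : L1 f -> L1 g -> L1 (fun w => f w - g w).
Proof. by move=> If Ig; exact: (integrableB measurableT If Ig). Qed.

Lemma L1Z c f : L1 f -> L1 (fun w => c * f w).
Proof. by move=> If; exact: (integrableZl measurableT c If). Qed.

Lemma L1_sum I (s : seq I) (p : pred I) (f : I -> T -> R) :
  (forall i, p i -> L1 (f i)) -> L1 (fun w => \sum_(i <- s | p i) f i w).
Proof.
move=> If; rewrite /L1; under [X in _.-integrable _ X]eq_fun do rewrite /= -sumEFin.
exact: integrable_sum.
Qed.

Lemma ExD f g : L1 f -> L1 g -> Ex (fun w => f w + g w) = Ex f + Ex g.
Proof. exact: RintegralD. Qed.

Lemma ExB f g : L1 f -> L1 g -> Ex (fun w => f w - g w) = Ex f - Ex g.
Proof. exact: RintegralB. Qed.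

Lemma ExZ c f : L1 f -> Ex (fun w => c * f w) = c * Ex f.
Proof. by move=> If; exact: RintegralZl. Qed.

Lemma Ex_cst c : Ex (fun=> c) = c.
Proof. by rewrite /Ex Rintegral_cst//= probability_setT mulr1. Qed.

Lemma Ex_sum I (s : seq I) (p : pred I) (f : I -> T -> R) :
  (forall i, L1 (f i)) ->
  Ex (fun w => \sum_(i <- s | p i) f i w) = \sum_(i <- s | p i) Ex (f i).
Proof.
move=> If; elim: s => [|i s ih].
  by under [X in Ex X]eq_fun do rewrite big_nil; rewrite Ex_cst big_nil.
under [X in Ex X]eq_fun do rewrite big_cons.
rewrite big_cons; case: ifP => // _; rewrite ExD ?ih//.
exact: L1_sum.
Qed.

Lemma le_Ex f g : L1 f -> L1 g -> (forall w, f w <= g w) -> Ex f <= Ex g.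
Proof. by move=> If Ig fg; apply: le_Rintegral. Qed.

Lemma le_normr_Ex f g : measurable_fun setT f -> (forall w, `|f w| <= g w) ->
  L1 g -> `|Ex f| <= Ex g.
Proof.
move=> mf fg Ig; have If := le_L1 mf fg Ig.
rewrite (le_trans (le_normr_Rintegral _ If))//; apply: le_Ex => //.
by apply: le_L1 Ig; [exact: measurableT_comp|move=> w; rewrite normr_id].
Qed.

Lemma EFin_Ex f : L1 f -> ((Ex f)%:E = \int[P]_w (f w)%:E)%E.
Proof. by move=> If; rewrite /Ex/= fineK//; exact: integrable_fin_num. Qed.

Lemma Ex_indic (A : set T) : measurable A -> Ex \1_A = fine (P A).
Proof. by move=> mA; rewrite /Ex /Rintegral integral_indic// setIT. Qed.

Lemma L1_ge0 f : measurable_fun setT f -> (forall w, 0 <= f w) ->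
  (\int[P]_w (f w)%:E < +oo)%E -> L1 f.
Proof.
move=> mf f0 foo; apply/integrableP; split; first exact/measurable_EFinP.
by under eq_integral do rewrite /= ger0_norm//.
Qed.

End expectation.

Lemma L1_distribution d (T : measurableType d) (R : realType) (P : probability T R)
   (X : {mfun T >-> R}) (f : R -> R) : measurable_fun setT f ->
  L1 P (fun w => f (X w)) -> L1 (distribution P X) f.
Proof.
move=> mf If; apply/integrableP; split; first exact/measurable_EFinP.
rewrite ge0_integral_distribution//; last first.
  by apply: measurableT_comp => //; exact/measurable_EFinP.
by move/integrableP: If => [].
Qed.

(** * Independence *)

Section independence.
Context d (T : measurableType d) (R : realType) (P : probability T R).

Definition indep d1 d2 (T1 : measurableType d1) (T2 : measurableType d2)
    (U : T -> T1) (V : T -> T2) :=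
  forall A B, measurable A -> measurable B ->
    (P (U @^-1` A `&` V @^-1` B) = P (U @^-1` A) * P (V @^-1` B))%E.

Lemma indep_comp d1 d2 d3 d4 (T1 : measurableType d1) (T2 : measurableType d2)
    (T3 : measurableType d3) (T4 : measurableType d4)
    (U : T -> T1) (V : T -> T2) (f : T1 -> T3) (g : T2 -> T4) :
  measurable_fun setT f -> measurable_fun setT g ->
  indep U V -> indep (f \o U) (g \o V).
Proof.
move=> mf mg UV A B mA mB; apply: (UV (f @^-1` A) (g @^-1` B)).
  by rewrite -[X in measurable X]setTI; exact: mf.
by rewrite -[X in measurable X]setTI; exact: mg.
Qed.

Variables (U V : {mfun T >-> R}).
Hypothesis UV : indep U V.

Definition paired w := (U w, V w).

Let mUV : measurable_fun [set: T] paired.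
Proof. exact: measurable_fun_pair. Qed.

HB.instance Definition _ := isMeasurableFun.Build _ _ _ _ paired mUV.

(** Independence says that the law of the pair and the product of the laws agree on rectangles, and
    rectangles determine the product measure. *)
Let joint (X : set (R * R)) : measurable X ->
  (distribution P U \x distribution P V)%E X =
  distribution P paired X.
Proof. by apply: product_measure_unique => A B mA mB; exact: UV. Qed.

(** Tonelli for the product law. No integrability is assumed, so the identity can also serve to
    prove that an expectation is finite. *)
Lemma indep_ge0_integralM (f g : R -> R) :
  measurable_fun setT f -> measurable_fun setT g ->
  (forall x, 0 <= f x) -> (forall x, 0 <= g x) ->
  (\int[P]_w (f (U w) * g (V w))%:E =
   \int[P]_w (f (U w))%:E * \int[P]_w (g (V w))%:E)%E.
Proof.
move=> mf mg f0 g0.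
have mfg : measurable_fun setT (fun x : R * R => (f x.1 * g x.2)%:E).
  by apply/measurable_EFinP/measurable_funM; exact: measurableT_comp.
have fg0 x : (0 <= (f x.1 * g x.2)%:E)%E by rewrite lee_fin mulr_ge0.
transitivity (\int[distribution P paired]_x (f x.1 * g x.2)%:E)%E.
  by rewrite ge0_integral_distribution.
rewrite -(eq_measure_integral _ (fun A mA _ => joint mA)).
rewrite fubini_tonelli1// /fubini_F/=.
under eq_integral => x _.
  under eq_integral do rewrite EFinM.
  rewrite ge0_integralZl//; first over.
  - exact/measurable_EFinP.
  - by move=> y _; rewrite lee_fin.
  - by rewrite lee_fin.
rewrite ge0_integralZr//.
- rewrite !ge0_integral_distribution//; do ?exact/measurable_EFinP.
- exact/measurable_EFinP.
- by move=> x _; rewrite lee_fin.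
- by apply: integral_ge0 => y _; rewrite lee_fin.
Qed.

Lemma indep_L1 (f g : R -> R) :
  measurable_fun setT f -> measurable_fun setT g ->
  L1 P (fun w => f (U w)) -> L1 P (fun w => g (V w)) ->
  L1 P (fun w => f (U w) * g (V w)).
Proof.
move=> mf mg /integrableP[_ If] /integrableP[_ Ig]; apply/integrableP; split.
  by apply/measurable_EFinP/measurable_funM; exact: measurableT_comp.
under eq_integral do rewrite /= normrM.
rewrite (indep_ge0_integralM (f := fun x => `|f x|) (g := fun x => `|g x|))//.
- by rewrite lte_mul_pinfty ?integral_ge0// ge0_fin_numE ?integral_ge0.
- exact: measurableT_comp.
- exact: measurableT_comp.
Qed.

(** The same computation for signed functions, by Fubini; integrability for the product law is
    transported from [P]. *)
Lemma indep_ExM (f g : R -> R) :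
  measurable_fun setT f -> measurable_fun setT g ->
  L1 P (fun w => f (U w)) -> L1 P (fun w => g (V w)) ->
  Ex P (fun w => f (U w) * g (V w)) = Ex P (fun w => f (U w)) * Ex P (fun w => g (V w)).
Proof.
move=> mf mg If Ig; have Ifg := indep_L1 mf mg If Ig.
have mfg : measurable_fun setT (fun x : R * R => f x.1 * g x.2).
  by apply/measurable_funM; exact: measurableT_comp.
apply: EFin_inj; rewrite EFinM !EFin_Ex//.
transitivity (\int[distribution P paired]_x (f x.1 * g x.2)%:E)%E.
  rewrite integral_distribution//; exact/measurable_EFinP.
rewrite -(eq_measure_integral _ (fun A mA _ => joint mA)).
have Jfg : (distribution P U \x distribution P V)%E.-integrable setT
    (fun x : R * R => (f x.1 * g x.2)%:E).
  apply/integrableP; split; first exact/measurable_EFinP.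
  rewrite (eq_measure_integral _ (fun A mA _ => joint mA)).
  rewrite ge0_integral_distribution//.
    by move/integrableP: Ifg => [].
  by apply: measurableT_comp => //; exact/measurable_EFinP.
rewrite -integral12_prod_meas1// /fubini_F/=.
have JU := L1_distribution mf If; have JV := L1_distribution mg Ig.
under eq_integral => x _.
  under eq_integral do rewrite EFinM.
  rewrite integralZl//; over.
rewrite /= -(fineK (integrable_fin_num measurableT JV)).
rewrite integralZr// fineK ?(integrable_fin_num measurableT JV)//.
by rewrite !integral_distribution//; exact/measurable_EFinP.
Qed.

End independence.

Lemma mutually_independent_comp d d1 d2 (T : measurableType d)
    (T1 : measurableType d1) (T2 : measurableType d2) (R : realType)
    (P : probability T R) (I : choiceType) (X : I -> T -> T1)
    (g : I -> T1 -> T2) :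
  (forall i, measurable_fun setT (g i)) ->
  mutually_independent P X -> mutually_independent P (fun i => g i \o X i).
Proof.
move=> mg iX J A mA.
rewrite (iX J (fun i => g i @^-1` A i))// => i iJ.
by rewrite -[X in measurable X]setTI; apply: mg => //; exact: mA.
Qed.

(** * Independence of one member of a family from the sum of the others *)

Section mutually_independent_sum.
Context d (T : measurableType d) (R : realType) (P : probability T R).
Variables (I : finType) (Y : I -> {mfun T >-> R}).
Hypothesis iY : mutually_independent P (fun i => Y i : T -> R).
Variable k : I.

(** A pi-system of events that do not involve [Y k], rich enough to make every other [Y i]
    measurable for the sigma-algebra that it generates. *)
Let cylinders : set (set T) := [set C | exists J : {fset I},
  exists2 A : I -> set R, forall i, measurable (A i) &
  k \notin J /\ C = \bigcap_(i in [set` J]) (Y i @^-1` A i)].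

Let cylindersT : cylinders setT.
Proof.
exists fset0, (fun=> setT) => //; split; first by rewrite in_fset0.
by apply/seteqP; split.
Qed.

Let measurableY i A : measurable A -> measurable (Y i @^-1` A).
Proof. by move=> mA; rewrite -[X in measurable X]setTI; exact: measurable_funPT. Qed.

Let cylinders_measurable : cylinders `<=` measurable.
Proof.
move=> _ [J [A mA [_ ->]]]; apply: fin_bigcap_measurable => // i _.
exact: measurableY.
Qed.

Let setI_cylinders : setI_closed cylinders.
Proof.
move=> _ _ [J [A mA [kJ ->]]] [K [B mB [kK ->]]].
(* Padding with [setT] outside [J] and outside [K] lets the union of the index sets carry both
   families. *)
exists (J `|` K)%fset, (fun i => (if i \in J then A i else setT) `&`
    (if i \in K then B i else setT)).
  by move=> i; apply: measurableI; case: ifP.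
split; first by rewrite in_fsetU negb_or kJ.
apply/seteqP; split => w /=.
  move=> [JA KB] i /=; rewrite in_fsetU; split.
    by case: ifP => // iJ; exact: JA.
  by case: ifP => // iK; exact: KB.
move=> JK; split => i /= iJ.
  by have := JK i; rewrite /= in_fsetU iJ => /(_ isT)[].
by have := JK i; rewrite /= in_fsetU iJ orbT => /(_ isT)[].
Qed.

(** Adjoining [k] to the index set, with [A] as its set, reduces the claim to mutual independence of
    the enlarged and of the original family. *)
Let cylinder_indep A C : measurable A -> cylinders C ->
  (P (Y k @^-1` A `&` C) = P (Y k @^-1` A) * P C)%E.
Proof.
move=> mA [J [B mB [kJ ->]]].
pose A' i := if i == k then A else B i.
have A'k : A' k = A by rewrite /A' eqxx.
have A'B i : i \in J -> A' i = B i.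
  by rewrite /A'; case: eqP => // ->; rewrite (negPf kJ).
have := iY (J := (k |` J)%fset) (A := A').
rewrite big_fsetU1//= bigcap_fsetU1 A'k.
have -> : \bigcap_(i in [set` J]) (Y i @^-1` A' i) =
    \bigcap_(i in [set` J]) (Y i @^-1` B i).
  by apply: eq_bigcapr => i /= iJ; rewrite A'B.
move=> ->; last by move=> i _; rewrite /A'; case: ifP.
by congr (_ * _)%E; rewrite iY//; apply: eq_big_seq => i iJ; rewrite A'B.
Qed.

(** Uniqueness of measures: [P (Y k^-1 A & C)] and [P (Y k^-1 A) P C] are finite measures in [C]
    that agree on the cylinders, hence on the generated sigma-algebra, which contains the events of
    the sum. *)
Lemma mutually_independent_indep_sum :
  indep P (Y k) (fun w => \sum_(i | i != k) Y i w).
Proof.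
move=> A B mA mB.
pose S := g_sigma_algebraType cylinders.
have mYS i : i != k -> measurable_fun [set: S] (Y i : S -> R).
  move=> ik _ C mC; rewrite setTI; apply: sub_sigma_algebra.
  exists [fset i]%fset, (fun=> C) => //; split.
    by rewrite in_fset1 eq_sym.
  by rewrite set_fset1 bigcap_set1.
have mVS : measurable_fun [set: S] ((fun w => \sum_(i | i != k) Y i w) : S -> R).
  (* Summing over a filtered list permits an induction that remembers that no index equals [k]. *)
  have -> : (fun w => \sum_(i | i != k) Y i w) =
    (fun w : S => \sum_(i <- [seq i <- index_enum I | i != k]) Y i w).
    by apply/funext => w; rewrite big_filter.
  have : all (fun i => i != k) [seq i <- index_enum I | i != k] by exact: filter_all.
  elim: [seq i <- index_enum I | i != k] => [_|i s ih /= /andP[ik /ih ms]].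
    by under eq_fun do rewrite big_nil; exact: measurable_cst.
  under eq_fun do rewrite big_cons.
  by apply: measurable_funD => //; exact: mYS.
have := mVS measurableT B mB; rewrite setTI => SB.
pose m1 := mrestr P (measurableY k mA).
pose p : {nonneg R} := NngNum (fine_ge0 (measure_ge0 P (Y k @^-1` A))).
pose m2 := mscale p P.
rewrite setIC.
have -> : (P (Y k @^-1` A) = p%:num%:E)%E.
  by rewrite /= fineK ?fin_num_measure//; exact: measurableY.
have := @g_sigma_algebra_measure_unique _ _ _ cylinders cylinders_measurable
  (fun=> setT) (fun=> cylindersT) _ m1 m2 setI_cylinders.
apply => //.
- by apply/seteqP; split => // w _; exists 0%N.
- move=> C cC; rewrite /m1 /m2 /= /mrestr /mscale/= setIC cylinder_indep//.
  by rewrite fineK ?fin_num_measure//; exact: measurableY.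
- move=> _; change (P (setT `&` Y k @^-1` A) < +oo)%E.
  by rewrite -ge0_fin_numE ?fin_num_measure//; apply: measurableI => //; exact: measurableY.
Qed.

End mutually_independent_sum.

(** * Stein's method for Fourier transforms *)

Section fourier_derivative.
Context d (T : measurableType d) (R : realType) (P : probability T R).
Implicit Types f g : T -> R.

Lemma measurable_cos_affine f s b : measurable_fun setT f ->
  measurable_fun setT (fun w => cos (s * f w + b)).
Proof.
move=> mf; apply: measurableT_comp => //.
  apply: continuous_measurable_fun; exact: continuous_cos.
by apply: measurable_funD => //; exact: measurable_funM.
Qed.

Lemma measurable_sin_affine f s b : measurable_fun setT f ->
  measurable_fun setT (fun w => sin (s * f w + b)).
Proof.
move=> mf; apply: measurableT_comp => //.
  apply: continuous_measurable_fun; exact: continuous_sin.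
by apply: measurable_funD => //; exact: measurable_funM.
Qed.

Lemma L1_cos_affine f s b : measurable_fun setT f ->
  L1 P (fun w => cos (s * f w + b)).
Proof.
move=> mf; apply: (@L1_bounded _ _ _ _ _ 1); first exact: measurable_cos_affine.
by move=> w; exact: cos_max.
Qed.

Lemma L1_sin_affine f s b : measurable_fun setT f ->
  L1 P (fun w => sin (s * f w + b)).
Proof.
move=> mf; apply: (@L1_bounded _ _ _ _ _ 1); first exact: measurable_sin_affine.
by move=> w; exact: sin_max.
Qed.

Lemma L1_mul_cos_affine f g s b : L1 P f -> measurable_fun setT g ->
  L1 P (fun w => f w * cos (s * g w + b)).
Proof.
move=> If mg; have mf := L1_measurable If.
apply: (@le_L1 _ _ _ _ _ (fun w => `|f w|)).
- by apply: measurable_funM => //; exact: measurable_cos_affine.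
- by move=> w; rewrite normrM ler_piMr// cos_max.
- apply: (@integrable_abse _ _ _ P setT (EFin \o f)) => //.
Qed.

Lemma L1_mul_sin_affine f g s b : L1 P f -> measurable_fun setT g ->
  L1 P (fun w => f w * sin (s * g w + b)).
Proof.
move=> If mg; have mf := L1_measurable If.
apply: (@le_L1 _ _ _ _ _ (fun w => `|f w|)).
- by apply: measurable_funM => //; exact: measurable_sin_affine.
- by move=> w; rewrite normrM ler_piMr// sin_max.
- apply: (@integrable_abse _ _ _ P setT (EFin \o f)) => //.
Qed.

(** Differentiation under the integral sign: the derivative of the integrand is dominated by [|f|],
    uniformly in the parameter. *)
Lemma is_derive_Ex_cos f (b s : R) : L1 P f ->
  is_derive s 1 (fun r => Ex P (fun w => cos (r * f w + b)))
    (- Ex P (fun w => f w * sin (s * f w + b))).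
Proof.
move=> If; have mf := L1_measurable If.
pose g (r : R) w := cos (r * f w + b).
have dg (r : R) w : is_derive r 1 (g ^~ w) (- (f w * sin (r * f w + b))).
  rewrite /g; apply: is_derive_eq; rewrite /GRing.scale/=; ring.
have pg r w : partial1of2 g r w = - (f w * sin (r * f w + b)).
  by rewrite partial1of2E; exact: derive_val.
have Is : `](s - 1), (s + 1)[%classic s by rewrite /= in_itv/=; lra.
have intg (r : R) : `](s - 1), (s + 1)[%classic r -> P.-integrable setT (EFin \o g r).
  by move=> _; exact: L1_cos_affine.
have derg (r : R) w : `](s - 1), (s + 1)[%classic r -> setT w -> derivable (g ^~ w) r 1.
  by move=> _ _; have [] := dg r w.
have intG : P.-integrable setT (EFin \o (fun w => `|f w|)) by exact: (integrable_abse If).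
have G_ub (r : R) w : `](s - 1), (s + 1)[%classic r -> setT w ->
    `|partial1of2 g r w| <= `|f w|.
  by move=> _ _; rewrite pg normrN normrM ler_piMr// sin_max.
have G_ge0 w : 0 <= `|f w| by [].
have D := derivable_under_integral measurableT Is intg derg G_ge0 intG G_ub.
have V := differentiation_under_integral measurableT Is intg derg G_ge0 intG G_ub.
apply: DeriveDef => //; rewrite -derive1E V.
under eq_Rintegral do rewrite pg -mulN1r.
by rewrite RintegralZl ?mulN1r//; exact: L1_mul_sin_affine.
Qed.

End fourier_derivative.

(** * Stein residuals of independent sums *)

Section stein_residual.
Context d (T : measurableType d) (R : realType) (P : probability T R).

(** By independence, the residual of [U + V] at phase [th] is the expectation of the residual of [U]
    at the random phase [s V + th], and each of these is at most [m]. *)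
Lemma indep_stein_residual (U V : {mfun T >-> R}) (a m s th : R) :
  indep P U V -> L1 P U ->
  (forall b, `|a * Ex P (fun w => cos (s * U w + b))
              - Ex P (fun w => U w * sin (s * U w + b))| <= m) ->
  `|a * Ex P (fun w => cos (s * (U w + V w) + th))
    - Ex P (fun w => U w * sin (s * (U w + V w) + th))| <= m.
Proof.
move=> UV IU Hm.
have [mU mV] : measurable_fun setT U /\ measurable_fun setT V by [].
(* The null phases keep these functions in the affine form of the measurability and integrability
   lemmas. *)
set f1 := fun x : R => cos (s * x + 0); set f2 := fun x : R => sin (s * x + 0).
set g1 := fun x : R => cos (s * x + th); set g2 := fun x : R => sin (s * x + th).
set f3 := fun x : R => x * sin (s * x + 0); set f4 := fun x : R => x * cos (s * x + 0).
have mf1 : measurable_fun setT f1 by exact: measurable_cos_affine.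
have mf2 : measurable_fun setT f2 by exact: measurable_sin_affine.
have mg1 : measurable_fun setT g1 by exact: measurable_cos_affine.
have mg2 : measurable_fun setT g2 by exact: measurable_sin_affine.
have mf3 : measurable_fun setT f3 by apply: measurable_funM => //.
have mf4 : measurable_fun setT f4 by apply: measurable_funM => //.
have If1 : L1 P (fun w => f1 (U w)) by exact: L1_cos_affine.
have If2 : L1 P (fun w => f2 (U w)) by exact: L1_sin_affine.
have Ig1 : L1 P (fun w => g1 (V w)) by exact: L1_cos_affine.
have Ig2 : L1 P (fun w => g2 (V w)) by exact: L1_sin_affine.
have If3 : L1 P (fun w => f3 (U w)) by exact: L1_mul_sin_affine.
have If4 : L1 P (fun w => f4 (U w)) by exact: L1_mul_cos_affine.
(* As a function of the phase [b], the residual of [U] is [A cos b - B sin b]. *)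
set A := a * Ex P (fun w => f1 (U w)) - Ex P (fun w => f3 (U w)).
set B := a * Ex P (fun w => f2 (U w)) + Ex P (fun w => f4 (U w)).
have hb b : a * Ex P (fun w => cos (s * U w + b))
              - Ex P (fun w => U w * sin (s * U w + b)) = A * cos b - B * sin b.
  have -> : (fun w => cos (s * U w + b)) =
      (fun w => cos b * f1 (U w) - sin b * f2 (U w)).
    by apply/funext => w; rewrite /f1 /f2 addr0 cosD; ring.
  have -> : (fun w => U w * sin (s * U w + b)) =
      (fun w => cos b * f3 (U w) + sin b * f4 (U w)).
    by apply/funext => w; rewrite /f3 /f4 addr0 sinD; ring.
  rewrite ExB ?ExD; do ?exact: L1Z.
  rewrite !ExZ// /A /B; ring.
have -> : (fun w => cos (s * (U w + V w) + th)) =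
    (fun w => f1 (U w) * g1 (V w) - f2 (U w) * g2 (V w)).
  by apply/funext => w; rewrite -cosD; congr cos; ring.
have -> : (fun w => U w * sin (s * (U w + V w) + th)) =
    (fun w => f3 (U w) * g1 (V w) + f4 (U w) * g2 (V w)).
  apply/funext => w; rewrite /f3 /f4 -!mulrA -mulrDr -sinD; congr (_ * sin _); ring.
rewrite ExB ?ExD; do ?exact: indep_L1.
rewrite !indep_ExM//.
have -> : a * (Ex P (fun w => f1 (U w)) * Ex P (fun w => g1 (V w)) -
     Ex P (fun w => f2 (U w)) * Ex P (fun w => g2 (V w))) -
  (Ex P (fun w => f3 (U w)) * Ex P (fun w => g1 (V w)) +
   Ex P (fun w => f4 (U w)) * Ex P (fun w => g2 (V w))) =
   Ex P (fun w => A * g1 (V w) - B * g2 (V w)).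
  rewrite ExB; do ?exact: L1Z.
  rewrite !ExZ// /A /B; ring.
rewrite -[leRHS](Ex_cst P); apply: le_normr_Ex.
- by apply: measurable_funB; apply: measurable_funM => //; exact: measurableT_comp.
- by move=> w; rewrite /g1 /g2 -hb.
- exact: L1_cst.
Qed.

Variables (I : finType) (Y : I -> {mfun T >-> R}).
Hypothesis iY : mutually_independent P (fun i => Y i : T -> R).
Hypothesis IY : forall i, L1 P (Y i).

Let W w := \sum_i Y i w.
Let var := \sum_i Ex P (fun w => Y i w ^+ 2).

(* Gronwall on [0, 1] for [s |-> exp (s^2 var / 2) E cos (s W + th)], whose
   derivative is [exp (s^2 var / 2)] times the sum of the Stein residuals. *)
Lemma fourier_gaussian_dist (c : I -> R) (K th : R) :
  (forall i s b, 0 <= s <= 1 ->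
    `|s * Ex P (fun w => Y i w ^+ 2) * Ex P (fun w => cos (s * Y i w + b))
      - Ex P (fun w => Y i w * sin (s * Y i w + b))| <= s * c i) ->
  \sum_i c i <= K * var ->
  `|Ex P (fun w => cos (W w + th)) - cos th * expR (- (2^-1 * var))|
    <= K * (1 - expR (- (2^-1 * var))).
Proof.
move=> Hc cK.
have IW : L1 P W by exact: L1_sum.
have mW := L1_measurable IW.
pose D (s : R) := Ex P (fun w => cos (s * W w + th)).
pose D' s := - Ex P (fun w => W w * sin (s * W w + th)).
have residual s : 0 <= s <= 1 -> `|s * var * D s + D' s| <= s * (K * var).
  move=> s01.
  have -> : s * var * D s + D' s = \sum_i (s * Ex P (fun w => Y i w ^+ 2) * D s -
      Ex P (fun w => Y i w * sin (s * W w + th))).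
    rewrite sumrB -!big_distrl/= -big_distrr/=; congr (_ * _ + - _).
    rewrite -Ex_sum; last by move=> i; exact: L1_mul_sin_affine.
    by congr Ex; apply/funext => w; rewrite big_distrl.
  rewrite (le_trans (ler_norm_sum _ _ _))//.
  apply: (@le_trans _ _ (\sum_i s * c i)); last first.
    by rewrite -big_distrr/= ler_wpM2l//; case/andP : s01.
  apply: ler_sum => i _; rewrite /D.
  have mV : measurable_fun setT (fun w => \sum_(j | j != i) Y j w).
    exact: L1_measurable (L1_sum _ _).
  pose V : {mfun T >-> R} := mfun_Sub (mem_set mV).
  have -> : W = (fun w => Y i w + V w) by apply/funext => w; rewrite /W (bigD1 i)//=.
  apply: indep_stein_residual => //; first exact: mutually_independent_indep_sum.
  by move=> b; exact: Hc.
pose e (s : R) := expR (s ^+ 2 * (2^-1 * var)).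
have de (s : R) : is_derive s 1 e (s * var * e s).
  by rewrite /e; apply: is_derive_eq; rewrite /GRing.scale/=; field.
(* The sign [sg] treats both halves of the absolute value. By [residual], [M] below has a
   nonnegative derivative on [0, 1], and [M 0 <= M 1] is the claim. *)
have main (sg : R) : `|sg| = 1 -> sg * (e 1 * D 1 - D 0) <= K * (e 1 - 1).
  move=> sg1; pose M s := K * e s - sg * (e s * D s).
  have dD (r : R) : is_derive r 1 D (D' r) by exact: is_derive_Ex_cos.
  have dM (r : R) : is_derive r 1 M
      (e r * (r * (K * var) - sg * (r * var * D r + D' r))).
    by rewrite /M; apply: is_derive_eq; rewrite /GRing.scale/= -/(e r); field.
  have cM : continuous M.
    by move=> r; apply/differentiable_continuous/derivable1_diffP; have [] := dM r.
  have : M 0 <= M 1.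
    apply: (@ger0_derive1_ndecr R M 0 1) => //; last exact: continuous_subspaceT.
      move=> r; rewrite in_itv/= => /andP[r0 r1].
      rewrite derive1E derive_val mulr_ge0 ?expR_ge0// subr_ge0.
      rewrite (le_trans (ler_norm _))// normrM sg1 mul1r residual//.
      by rewrite !ltW.
  by rewrite /M /e expr0n/= mul0r expR0; lra.
have D1 : D 1 = Ex P (fun w => cos (W w + th)).
  by congr Ex; apply/funext => w; rewrite mul1r.
have D0 : D 0 = cos th.
  by rewrite -[RHS](Ex_cst P); congr Ex; apply/funext => w; rewrite mul0r add0r.
have e1 : e 1 = (expR (- (2^-1 * var)))^-1 by rewrite /e expr1n mul1r expRN invrK.
(* With [x = exp (- var / 2) = 1 / e 1], the goal is [main] for both signs, multiplied by [x]. *)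
have x0 := expR_gt0 (- (2^-1 * var)); move: x0 main.
rewrite e1 D0 D1; move: (expR _) (Ex _ _) => x y x0 main.
have eqM z : z = x * (x^-1 * z) by rewrite mulrA divff ?mul1r// gt_eqF.
rewrite (_ : y - _ = x * (x^-1 * y - cos th)); last first.
  by rewrite mulrBr -eqM mulrC.
rewrite (_ : K * (1 - x) = x * (K * (x^-1 - 1))); last by field; rewrite gt_eqF.
rewrite normrM gtr0_norm//; apply: ler_wpM2l; first exact: ltW.
rewrite ler_norml lerNl.
have := main 1; have := main (-1).
by rewrite normrN normr1 mulN1r mul1r => -> // ->.
Qed.

End stein_residual.

(** * The Stein residual of a centred variable, cut at a level *)

Section truncation.
Context d (T : measurableType d) (R : realType) (P : probability T R).

Lemma L1_sqr (f : T -> R) : measurable_fun setT f ->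
  L1 P (fun w => f w ^+ 2) -> L1 P f.
Proof.
move=> mf If; apply: (le_L1 (g := fun w => 1 + f w ^+ 2)) => //.
  move=> w; rewrite -[f w ^+ 2]real_normK ?num_real//.
  move: `|f w| => x; have := sqr_ge0 (x - 1); have := sqr_ge0 x.
  rewrite sqrrB; lra.
by apply: L1D => //; exact: L1_cst.
Qed.

Lemma L1_sqr_mul (f g : T -> R) : measurable_fun setT f -> measurable_fun setT g ->
  L1 P (fun w => f w ^+ 2) -> L1 P (fun w => g w ^+ 2) ->
  L1 P (fun w => f w * g w).
Proof.
move=> mf mg If Ig; apply: (le_L1 (g := fun w => f w ^+ 2 + g w ^+ 2)).
- exact: measurable_funM.
- move=> w; rewrite normrM -[f w ^+ 2]real_normK ?num_real//.
  rewrite -[g w ^+ 2]real_normK ?num_real//.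
  move: `|f w| `|g w| (normr_ge0 (f w)) (normr_ge0 (g w)) => x y x0 y0.
  have := mulr_ge0 x0 y0; have := sqr_ge0 (x - y); rewrite sqrrB; lra.
- exact: L1D.
Qed.

Lemma L1_mul_indic (f : T -> R) (A : set T) : measurable A ->
  L1 P f -> L1 P (fun w => f w * \1_A w).
Proof.
move=> mA If; have mf := L1_measurable If.
apply: (le_L1 (g := fun w => `|f w|)).
- by apply: measurable_funM => //; exact: measurable_indic.
- by move=> w; rewrite normrM ler_piMr// indicE; case: (_ \in _); rewrite ?normr1 ?normr0.
- exact: (integrable_abse If).
Qed.

Lemma L1_indic (A : set T) : measurable A -> L1 P \1_A.
Proof.
move=> mA; apply: (@L1_bounded _ _ _ _ _ 1); first exact: measurable_indic.
by move=> w; rewrite indicE; case: (_ \in _); rewrite ?normr1 ?normr0.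
Qed.

(** Expand to first order: [cos (s Y + b)] about [cos b], and [Y sin (s Y + b)] about
    [Y sin b + s Y^2 cos b]. As [Y] is centred, the main terms [s E[Y^2] cos b] cancel. The
    remainders are of order [eps] where [|Y| <= eps], and crude bounds on the tail give the first
    two terms; each expansion contributes one [eps E[Y^2]]. *)
Lemma stein_residual_truncated (Y : {mfun T >-> R}) (eps s b : R) :
  L1 P (fun w => Y w ^+ 2) -> Ex P Y = 0 -> 0 < eps -> 0 <= s <= 1 ->
  `|s * Ex P (fun w => Y w ^+ 2) * Ex P (fun w => cos (s * Y w + b))
    - Ex P (fun w => Y w * sin (s * Y w + b))|
  <= s * (2 * Ex P (fun w => Y w ^+ 2 * \1_[set w | eps < `|Y w|] w) +
          2 * Ex P (fun w => Y w ^+ 2) * Ex P \1_[set w | eps < `|Y w|] +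
          2 * eps * Ex P (fun w => Y w ^+ 2)).
Proof.
move=> IY2 EY eps0 /andP[s0 s1].
set A := [set w | eps < `|Y w|]; set v := Ex P (fun w => Y w ^+ 2).
have mY : measurable_fun setT Y by [].
have mA : measurable A.
  rewrite -[A]setTI; apply: (@measurable_fun_ltr _ _ _ setT (fun=> eps)) => //.
  exact: measurableT_comp.
have IY : L1 P Y by exact: L1_sqr.
have v0 : 0 <= v by apply: Rintegral_ge0 => w _; exact: sqr_ge0.
have sY w : `|s * Y w| <= `|Y w| by rewrite normrM ger0_norm// ler_piMl.
have IA := L1_indic mA.
have IYA := L1_mul_indic mA IY2.
have Ic : L1 P (fun w => cos (s * Y w + b)) by exact: L1_cos_affine.
have IYs : L1 P (fun w => Y w * sin (s * Y w + b)) by exact: L1_mul_sin_affine.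
have cosE : `|Ex P (fun w => cos (s * Y w + b) - cos b)| <= 2 * Ex P \1_A + eps.
  rewrite -ExZ// -[X in _ + X](Ex_cst P) -ExD; [|exact: L1Z|exact: L1_cst].
  apply: le_normr_Ex.
  - exact: L1_measurable (L1B Ic (L1_cst _ _)).
  - move=> w; rewrite indicE; case: (boolP (w \in A)) => [_|].
      by rewrite mulr1 (le_trans (cosB_le2 _ _))// lerDl ltW.
    rewrite notin_setE/= => /negP; rewrite -leNgt => Yeps.
    rewrite mulr0 add0r (le_trans (ler_dist_cos _ _))// addrK.
    exact: le_trans (sY w) Yeps.
  - by apply: L1D; [exact: L1Z|exact: L1_cst].
have sinE : `|Ex P (fun w => Y w * sin (s * Y w + b) -
      (sin b * Y w + (s * cos b) * Y w ^+ 2))| <=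
    s * (2 * Ex P (fun w => Y w ^+ 2 * \1_A w) + eps * v).
  rewrite -!ExZ// -ExD; do ?exact: L1Z.
  rewrite -ExZ; last by apply: L1D; exact: L1Z.
  apply: le_normr_Ex.
  - apply: L1_measurable (L1B IYs _); first by apply: L1D; exact: L1Z.
  - move=> w.
    have -> : Y w * sin (s * Y w + b) - (sin b * Y w + s * cos b * Y w ^+ 2) =
      Y w * (sin (s * Y w + b) - sin b - s * Y w * cos b) by ring.
    rewrite normrM -[Y w ^+ 2]real_normK ?num_real// indicE.
    have Y0 := normr_ge0 (Y w).
    case: (boolP (w \in A)) => [_|].
      rewrite (le_trans (ler_wpM2l Y0 (sin_taylor1_le2 _ _)))//.
      rewrite normrM (ger0_norm s0) mulr1.
      rewrite (_ : _ * (2 * _) = s * (2 * `|Y w| ^+ 2)); last by ring.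
      by rewrite ler_wpM2l// lerDl mulr_ge0 ?sqr_ge0// ltW.
    rewrite notin_setE/= => /negP; rewrite -leNgt => Yeps.
    rewrite (le_trans (ler_wpM2l Y0 (sin_taylor1 _ _)))//.
    rewrite -real_normK ?num_real// normrM (ger0_norm s0).
    (* One factor [s] is kept for the bound; the other is absorbed by [s |Y| <= eps], which uses
       [s <= 1]. *)
    rewrite (_ : _ * _ ^+ 2 = s * (s * `|Y w| * `|Y w| ^+ 2)); last by ring.
    rewrite ler_wpM2l// mulr0 mulr0 add0r ler_wpM2r ?sqr_ge0//.
    by rewrite -[leRHS]mul1r ler_pM.
  - by apply: L1Z; apply: L1D; exact: L1Z.
have -> : s * v * Ex P (fun w => cos (s * Y w + b))
    - Ex P (fun w => Y w * sin (s * Y w + b)) =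
  s * v * Ex P (fun w => cos (s * Y w + b) - cos b) -
    Ex P (fun w => Y w * sin (s * Y w + b) -
      (sin b * Y w + (s * cos b) * Y w ^+ 2)).
  rewrite !ExB ?ExD ?ExZ ?Ex_cst ?EY//; do ?[exact: L1_cst|exact: L1Z].
    rewrite /v; ring.
  by apply: L1D; exact: L1Z.
rewrite (le_trans (ler_normB _ _))// normrM (ger0_norm (mulr_ge0 s0 v0)).
have := ler_wpM2l (mulr_ge0 s0 v0) cosE.
move: sinE; lra.
Qed.

End truncation.

(** * The standard normal law *)

Section gaussian_stein_identity.
Variable R : realType.
Local Notation mu := (@lebesgue_measure R).
Local Notation N01 := (@normal_prob R 0 1).

(** The fundamental theorem on growing symmetric intervals, followed by dominated convergence with
    [|f|] as the dominating function. *)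
Lemma Rintegral_derive_eq0 (F f : R -> R) :
  (forall x : R, is_derive x 1 F (f x)) -> continuous f ->
  mu.-integrable setT (EFin \o f) ->
  F n.+1%:R @[n --> \oo] --> 0 -> F (- n.+1%:R) @[n --> \oo] --> 0 ->
  \int[mu]_x f x = 0.
Proof.
move=> Ff cf If Fp Fm.
(* The successor keeps the interval nondegenerate at [n = 0]. *)
pose A n : set R := `[- n.+1%:R, n.+1%:R]%classic.
have mf := measurable_int _ If.
have FTC n : (\int[mu]_x ((EFin \o f) \_ (A n)) x = (F n.+1%:R - F (- n.+1%:R))%R%:E)%E.
  rewrite -integral_mkcond (@continuous_FTC2 _ f F)//.
  - by rewrite -subr_gt0 opprK addr_gt0.
  - exact: continuous_subspaceT.
  - have cF : continuous F.
      by move=> x; apply/differentiable_continuous/derivable1_diffP; have [] := Ff x.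
    split.
    + by move=> x _; have [] := Ff x.
    + exact/cvg_at_right_filter/cF.
    + exact/cvg_at_left_filter/cF.
  - by move=> x _; rewrite derive1E derive_val.
have : (F n.+1%:R - F (- n.+1%:R))%:E @[n --> \oo] --> (\int[mu]_x (f x)%:E)%E.
  under eq_fun do rewrite -FTC.
  apply: (@dominated_cvg _ _ _ mu setT measurableT _ _ (abse \o (EFin \o f))) => //.
  - move=> n; apply/(measurable_restrictT _ _).1; first exact: measurable_itv.
    exact: measurable_funTS.
  - move=> x _; apply: cvg_near_cst.
    near=> n; rewrite patchE mem_set//= /A/= in_itv/= -ler_norml.
    rewrite (@le_trans _ _ n%:R)// ?ler_nat//.
    by near: n; exact: nbhs_infty_ger.
  - exact: integrable_abse.
  - move=> n x _; rewrite patchE; case: ifPn => //=; by rewrite normr0 lee_fin.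
have : (F n.+1%:R - F (- n.+1%:R))%:E @[n --> \oo] --> (0 - 0)%:E.
  by apply: cvg_EFin; [exact: nearW|apply: cvgB].
move=> /cvg_unique h /h; rewrite subr0 /Rintegral => <- //.
Unshelve. all: end_near. Qed.

Local Notation p := (@normal_pdf R 0 1).

Let pE x : p x = normal_peak 1 * expR (- (x ^+ 2 / 2)).
Proof.
by rewrite normal_pdfE ?oner_eq0// /normal_fun subr0 expr1n mulr2n mulNr.
Qed.

Let is_derive_pdf (x : R) : is_derive x 1 p (- x * p x).
Proof.
rewrite (_ : p = fun x => normal_peak 1 * expR (- (x ^+ 2 / 2))).
  by apply: is_derive_eq; rewrite /GRing.scale/=; field.
by apply/funext => y; rewrite pE.
Qed.

(** Domination by a multiple of the normal density of standard deviation 2: the surplus Gaussian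
    decay absorbs the polynomial. *)
Lemma integrable_moment2_normal_pdf :
  mu.-integrable setT (EFin \o (fun x => (1 + x ^+ 2) * p x)).
Proof.
have mp := @measurable_normal_pdf R 0 1.
have n2 : (2 : R) != 0 by rewrite pnatr_eq0.
(* (1 + x^2) exp (- 3 x^2 / 8) <= 1 + 8 / 3 *)
pose K : R := normal_peak 1 / normal_peak 2 * (11 / 3).
have IK : mu.-integrable setT (fun x => K%:E * (normal_pdf 0 2 x)%:E)%E.
  by apply: integrableZl => //; exact: integrable_normal_pdf.
apply: le_integrable IK => //.
  apply/measurable_EFinP; apply: measurable_funM => //.
  exact: measurable_funD.
move=> x _; rewrite /= lee_fin.
have p1 : 0 < normal_peak (1 : R) by rewrite normal_peak_gt0 ?oner_eq0.
have p2 : 0 < normal_peak (2 : R) by rewrite normal_peak_gt0.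
rewrite !ger0_norm; last 2 first.
- by rewrite mulr_ge0 ?normal_pdf_ge0// mulr_ge0 ?divr_ge0 ?ltW.
- by rewrite mulr_ge0 ?normal_pdf_ge0// addr_ge0// sqr_ge0.
rewrite pE normal_pdfE// /normal_fun subr0 /K.
rewrite (_ : _ / _ * _ * _ = normal_peak 1 *
    (11 / 3 * expR (- x ^+ 2 / (2 ^+ 2 *+ 2)))); last first.
  by field; rewrite gt_eqF.
rewrite mulrCA; apply: ler_wpM2l; first exact: ltW.
rewrite (_ : - (x ^+ 2 / 2) = - (3 / 8 * x ^+ 2) + - x ^+ 2 / (2 ^+ 2 *+ 2)); last first.
  by field.
rewrite expRD mulrA ler_wpM2r ?expR_ge0//.
rewrite expRN ler_pdivrMr ?expR_gt0//.
have := expR_ge1Dx (3 / 8 * x ^+ 2); have := sqr_ge0 x; lra.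
Qed.

Let harmonic_cvg0 (c : R) : c * n.+1%:R^-1 @[n --> \oo] --> 0.
Proof.
by rewrite -[X in _ --> X](mulr0 c); apply: cvgM; [exact: cvg_cst|exact: cvg_harmonic].
Qed.

(** The integrand is the derivative of [f p], since [p' = - x p], and [f p] vanishes at both
    infinities because [f] grows at most linearly. *)
Lemma normal_stein_lebesgue (f df : R -> R) (C : R) :
  (forall x : R, is_derive x 1 f (df x)) -> continuous df ->
  (forall x, `|f x| <= C * (1 + `|x|)) -> (forall x, `|df x| <= C) ->
  mu.-integrable setT (EFin \o (fun x => (df x - x * f x) * p x)) /\
  \int[mu]_x ((df x - x * f x) * p x) = 0.
Proof.
move=> fdf cdf fC dfC.
have C0 : 0 <= C by rewrite (le_trans _ (dfC 0)).
have cp : continuous p by apply: continuous_normal_pdf; rewrite oner_eq0.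
have cf : continuous f.
  by move=> x; apply/differentiable_continuous/derivable1_diffP; have [] := fdf x.
have cg : continuous (fun x => (df x - x * f x) * p x).
  move=> x; apply: cvgM; last exact: cp.
  apply: cvgB; first exact: cdf.
  by apply: cvgM; [exact: cvg_id|exact: cf].
have Ig : mu.-integrable setT (EFin \o (fun x => (df x - x * f x) * p x)).
  (* From [|df| + |x| |f| <= C (1 + |x| + x^2) <= 2 C (1 + x^2)]. *)
  have IK : mu.-integrable setT (fun x => (2 * C)%:E * ((1 + x ^+ 2) * p x)%:E)%E.
    by apply: integrableZl => //; exact: integrable_moment2_normal_pdf.
  apply: le_integrable IK => //.
    by apply/measurable_EFinP; exact: continuous_measurable_fun.
  move=> x _; rewrite /= lee_fin.
  have p0 := @normal_pdf_ge0 R 0 1 x.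
  have x2 := sqr_ge0 x.
  rewrite normrM (ger0_norm p0) [leRHS]ger0_norm; last first.
    by rewrite !mulr_ge0// addr_ge0.
  rewrite mulrA ler_wpM2r// (le_trans (ler_normB _ _))// normrM.
  have := dfC x; have := ler_wpM2l (normr_ge0 x) (fC x).
  rewrite -[x ^+ 2]real_normK ?num_real//.
  move: `|x| (normr_ge0 x) `|df x| (`|x| * _) => y y0 a b ab ba.
  have := mulr_ge0 C0 (sqr_ge0 (y - 1)); rewrite sqrrB => ?.
  have := mulr_ge0 C0 (sqr_ge0 y); lra.
split => //.
(* The 4 comes from [exp (x^2 / 2) >= 1 + x^2 / 2 >= (x + 1)^2 / 4]; one of the two factors [x + 1]
   pays for the growth of [f]. *)
have bnd x : 0 <= x -> forall y, `|y| = x ->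
    `|f y * p y| <= C * normal_peak 1 * 4 * (x + 1)^-1.
  move=> x0 y yx.
  have pk0 := normal_peak_ge0 (1 : R).
  rewrite normrM [X in _ * X]ger0_norm ?normal_pdf_ge0// pE.
  have x10 : 0 < x + 1 by lra.
  apply: (@le_trans _ _ (C * (1 + x) * (normal_peak 1 * expR (- (y ^+ 2 / 2))))).
    by rewrite ler_wpM2r ?mulr_ge0 ?expR_ge0// -yx.
  rewrite (_ : _ * 4 * _ = C * (1 + x) * (normal_peak 1 * (4 / (x + 1) ^+ 2))); last first.
    by field; rewrite gt_eqF.
  rewrite ler_wpM2l ?mulr_ge0//; first by lra.
  rewrite ler_wpM2l// expRN ler_pdivlMr ?exprn_gt0//.
  rewrite mulrC ler_pdivrMr ?expR_gt0//.
  rewrite -[y ^+ 2]real_normK ?num_real// yx.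
  have := expR_ge1Dx (x ^+ 2 / 2); have := sqr_ge0 (x - 1).
  rewrite sqrrB sqrrD; lra.
have lim (s : R) : `|s| = 1 -> f (s * n.+1%:R) * p (s * n.+1%:R) @[n --> \oo] --> 0.
  move=> s1; apply: norm_cvg0.
  apply: (@squeeze_cvgr _ _ _ _ (cst 0)
    (fun n => C * normal_peak 1 * 4 * n.+2%:R^-1)); last 2 first.
  - exact: cvg_cst.
  - have := harmonic_cvg0 (C * normal_peak 1 * 4).
    by rewrite -(cvg_shiftS (fun n => C * normal_peak 1 * 4 * n.+1%:R^-1)).
  apply: nearW => n; rewrite normr_ge0/=.
  by rewrite -[n.+2]addn1 natrD; apply: bnd => //; rewrite normrM s1 mul1r normr_nat.
apply: (@Rintegral_derive_eq0 (fun x => f x * p x)) => //.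
- move=> x; have := is_derive_pdf x => ?; have := fdf x => ?.
  apply: is_derive_eq; rewrite /GRing.scale/=; ring.
- by have := lim 1; rewrite normr1 => /(_ erefl); under eq_fun do rewrite mul1r.
- have := lim (-1); rewrite normrN1 => /(_ erefl).
  by under eq_fun do rewrite mulN1r.
Qed.

End gaussian_stein_identity.

(** * Stein's identity for a standard normal random variable *)

Section standard_normal_variable.
Context d (T : measurableType d) (R : realType) (P : probability T R).
Local Notation mu := (@lebesgue_measure R).
Local Notation N01 := (@normal_prob R 0 1).
Local Notation p := (@normal_pdf R 0 1).

Let mp : measurable_fun setT (EFin \o p).
Proof. by apply/measurable_EFinP; exact: measurable_normal_pdf. Qed.

(** The Radon-Nikodym derivative is determined almost everywhere by its integrals over measurable
    sets, so it may be replaced by the density [p]. *)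
Lemma ge0_integral_normal_prob (f : R -> R) :
  measurable_fun setT f -> (forall x, 0 <= f x) ->
  (\int[N01]_x (f x)%:E = \int[mu]_x (f x * p x)%:E)%E.
Proof.
move=> mf f0; have dom := @normal_prob_dominates R 0 1.
have mf' : measurable_fun setT (EFin \o f) by exact/measurable_EFinP.
rewrite -(Radon_Nikodym_SigmaFinite.change_of_variables dom)//.
have Irn := Radon_Nikodym_SigmaFinite.f_integrable dom.
apply: ge0_ae_eq_integral => //.
- by apply: emeasurable_funM => //; exact: measurable_int Irn.
- by apply/measurable_EFinP; apply: measurable_funM => //; exact: measurable_normal_pdf.
- move=> x _; apply: mule_ge0; first by rewrite lee_fin.
  exact: Radon_Nikodym_SigmaFinite.f_ge0.
- by move=> x _; rewrite lee_fin mulr_ge0// normal_pdf_ge0.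
- under [X in ae_eq _ _ _ X]eq_fun do rewrite EFinM.
  apply: ae_eqe_mul2l; apply: integral_ae_eq => //.
  move=> E _ mE; rewrite -Radon_Nikodym_SigmaFinite.f_integral//.
Qed.

Variable G : {mfun T >-> R}.
Hypothesis GN : forall A, measurable A -> P (G @^-1` A) = N01 A.

Let ge0_integral_normal (f : R -> R) :
  measurable_fun setT f -> (forall x, 0 <= f x) ->
  (\int[P]_w (f (G w))%:E = \int[mu]_x (f x * p x)%:E)%E.
Proof.
move=> mf f0; rewrite -ge0_integral_normal_prob//.
have mG : measurable_fun setT (G : T -> measurableTypeR R).
  exact: (@measurable_funPT _ _ _ _ G).
pose G' : {mfun T >-> measurableTypeR R} :=
  @mfun_Sub _ _ T (measurableTypeR R) G (mem_set mG).
rewrite (@eq_measure_integral _ _ _ setT (distribution P G') N01).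
  by rewrite (@ge0_integral_distribution _ _ _ _ _ P G' (EFin \o f))//; exact/measurable_EFinP.
by move=> A mA _; exact/esym/GN.
Qed.

(** The formula for nonnegative functions extends to [f = (f + |f|) - |f|], a difference of two such
    functions. *)
Lemma normal_L1_Ex (f : R -> R) : measurable_fun setT f ->
  mu.-integrable setT (EFin \o (fun x => f x * p x)) ->
  L1 P (fun w => f (G w)) /\ Ex P (fun w => f (G w)) = \int[mu]_x (f x * p x).
Proof.
move=> mf Ifp.
have p0 x : 0 <= p x by exact: normal_pdf_ge0.
have nfp : (fun x => `|f x| * p x) = (fun x => `|f x * p x|).
  by apply/funext => x; rewrite normrM (ger0_norm (p0 x)).
have Infp : mu.-integrable setT (EFin \o (fun x => `|f x| * p x)).
  by rewrite nfp; exact: (integrable_abse Ifp).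
have If : L1 P (fun w => f (G w)).
  apply/integrableP; split; first by apply/measurable_EFinP; exact: measurableT_comp.
  rewrite (ge0_integral_normal (f := fun x => `|f x|))//; last exact: measurableT_comp.
  exact: integrable_lty.
split => //.
have Inf : L1 P (fun w => `|f (G w)|) by exact: (integrable_abse If).
have -> : (fun w => f (G w)) = (fun w => (f (G w) + `|f (G w)|) - `|f (G w)|).
  by apply/funext => w; rewrite addrK.
rewrite ExB//; last exact: L1D.
rewrite /Ex /Rintegral (ge0_integral_normal (f := fun x => `|f x|))//; last 1 first.
  exact: measurableT_comp.
rewrite (ge0_integral_normal (f := fun x => f x + `|f x|))//; last 2 first.
- by apply: measurable_funD => //; exact: measurableT_comp.
- by move=> x; have := ler_norm (- f x); rewrite normrN; lra.
rewrite -!/(Rintegral mu setT _) -RintegralB//.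
  by apply: eq_Rintegral => x _; rewrite mulrDl addrK.
have -> : EFin \o (fun x => (f x + `|f x|) * p x) =
    (fun x => (f x * p x)%:E + (`|f x| * p x)%:E)%E.
  by apply/funext => x /=; rewrite -EFinD mulrDl.
exact: integrableD.
Qed.

Lemma normal_stein (f df : R -> R) (C : R) :
  (forall x : R, is_derive x 1 f (df x)) -> continuous df ->
  (forall x, `|f x| <= C * (1 + `|x|)) -> (forall x, `|df x| <= C) ->
  L1 P (fun w => df (G w) - G w * f (G w)) /\
  Ex P (fun w => df (G w) - G w * f (G w)) = 0.
Proof.
move=> fdf cdf fC dfC; have [I0 E0] := normal_stein_lebesgue fdf cdf fC dfC.
have cf : continuous f.
  by move=> x; apply/differentiable_continuous/derivable1_diffP; have [] := fdf x.
have mg : measurable_fun setT (fun x => df x - x * f x).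
  apply: measurable_funB; first exact: continuous_measurable_fun.
  by apply: measurable_funM => //; exact: continuous_measurable_fun.
by rewrite -E0; apply: (@normal_L1_Ex (fun x => df x - x * f x)).
Qed.

(** Stein's identity for the identity function: [1 - G^2] is integrable with mean 0. *)
Lemma normal_moment2 :
  L1 P (fun w => G w ^+ 2) /\ Ex P (fun w => G w ^+ 2) = 1.
Proof.
have [I0] : L1 P (fun w => 1 - G w * G w) /\ Ex P (fun w => 1 - G w * G w) = 0.
  apply: (@normal_stein id (fun=> 1) 1).
  - by move=> x; exact: cvg_cst.
  - by move=> x; rewrite mul1r lerDr.
  - by move=> x; rewrite normr1.
have I2 : L1 P (fun w => G w ^+ 2).
  have -> : (fun w => G w ^+ 2) = (fun w => 1 - (1 - G w * G w)).
    by apply/funext => w; ring.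
  by apply: L1B => //; exact: L1_cst.
rewrite ExB ?Ex_cst//; last exact: L1_cst.
by move=> /eqP; rewrite subr_eq0 => /eqP <-.
Qed.

(** Stein's identity for [sin (a x + b)]; it makes the Stein residuals of a standard normal variable
    vanish at every phase. *)
Lemma normal_stein_sin (a b : R) :
  a * Ex P (fun w => cos (a * G w + b)) = Ex P (fun w => G w * sin (a * G w + b)).
Proof.
have [I0] : L1 P (fun w => a * cos (a * G w + b) - G w * sin (a * G w + b)) /\
    Ex P (fun w => a * cos (a * G w + b) - G w * sin (a * G w + b)) = 0.
  apply: (@normal_stein (fun x => sin (a * x + b)) (fun x => a * cos (a * x + b)) (1 + `|a|)).
  - by move=> x; apply: is_derive_eq; rewrite /GRing.scale/=; ring.
  - move=> x; apply: cvgM; first exact: cvg_cst.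
    apply: (cvg_comp _ cos); last exact: continuous_cos.
    apply: cvgD; last exact: cvg_cst.
    by apply: cvgM; [exact: cvg_cst|exact: cvg_id].
  - move=> x; rewrite (le_trans (sin_max _))//.
    have := normr_ge0 a; have := normr_ge0 x.
    have := mulr_ge0 (normr_ge0 a) (normr_ge0 x); lra.
  - by move=> x; rewrite normrM (@le_trans _ _ `|a|)// ?lerDr// ler_piMr// cos_max.
have mG : measurable_fun setT G by [].
have Ic : L1 P (fun w => a * cos (a * G w + b)) by apply: L1Z; exact: L1_cos_affine.
have Is : L1 P (fun w => G w * sin (a * G w + b)).
  apply: L1_mul_sin_affine => //; apply: L1_sqr => //; exact: normal_moment2.1.
by rewrite ExB// ExZ; [move=> /eqP; rewrite subr_eq0 => /eqP|exact: L1_cos_affine].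
Qed.

End standard_normal_variable.

(** * Euclidean structure of row vectors *)

Section row_vectors.
Context (R : realType) (N : nat).
Implicit Types x y t : 'rV[R]_N.

Lemma measurable_coord i : measurable_fun setT (fun x : 'rV[R]_N => x ord0 i).
Proof.
move=> _ Y mY; rewrite setTI; apply: sub_sigma_algebra => /=.
rewrite -bigcup_seq/=; exists i => /=; first by rewrite mem_index_enum.
by exists Y => //; rewrite setTI.
Qed.

Lemma measurable_dotv t : measurable_fun setT (dotv t).
Proof.
apply: measurable_sum => i; apply: measurable_funM => //.
exact: measurable_coord.
Qed.

Lemma dotvC x y : dotv x y = dotv y x.
Proof. by apply: eq_bigr => i _; rewrite mulrC. Qed.

Lemma enorm_sqr x : enorm x ^+ 2 = \sum_i x ord0 i ^+ 2.
Proof.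
rewrite sqr_sqrtr; first by apply: eq_bigr => i _; rewrite expr2.
by apply: sumr_ge0 => i _; rewrite -expr2 sqr_ge0.
Qed.

(** Cauchy-Schwarz by Lagrange's identity: the defect is half the sum of the squares of all 2 by 2
    minors. *)
Lemma dotv_sqr_le x y : dotv x y ^+ 2 <= enorm x ^+ 2 * enorm y ^+ 2.
Proof.
rewrite !enorm_sqr -subr_ge0.
suff -> : (\sum_i x ord0 i ^+ 2) * (\sum_i y ord0 i ^+ 2) - dotv x y ^+ 2 =
  2^-1 * \sum_i \sum_j (x ord0 i * y ord0 j - x ord0 j * y ord0 i) ^+ 2.
  rewrite mulr_ge0// sumr_ge0// => i _; apply: sumr_ge0 => j _; exact: sqr_ge0.
under [in RHS]eq_bigr do under eq_bigr do rewrite sqrrB.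
set u := fun i => x ord0 i; set v := fun i => y ord0 i.
have e1 : \sum_i \sum_j u i ^+ 2 * v j ^+ 2 = (\sum_i u i ^+ 2) * (\sum_i v i ^+ 2).
  by rewrite mulr_suml; apply: eq_bigr => i _; rewrite mulr_sumr.
have e2 : \sum_i \sum_j (u i * v i) * (u j * v j) = dotv x y ^+ 2.
  by rewrite expr2 {1}/dotv mulr_suml; apply: eq_bigr => i _; rewrite mulr_sumr.
transitivity (2^-1 * (\sum_i \sum_j (u i ^+ 2 * v j ^+ 2) + \sum_j \sum_i (u i ^+ 2 * v j ^+ 2)
   - 2 * \sum_i \sum_j (u i * v i) * (u j * v j))).
  by rewrite [X in _ + X - _]exchange_big e1 e2 /=; field.
congr (_ * _); rewrite mulr_sumr -big_split/= -sumrB; apply: eq_bigr => i _.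
rewrite mulr_sumr -big_split/= -sumrB; apply: eq_bigr => j _; rewrite /u /v; ring.
Qed.

Lemma dotvZr (c : R) x y : dotv x (c *: y) = c * dotv x y.
Proof. by rewrite /dotv mulr_sumr; apply: eq_bigr => i _; rewrite mxE mulrCA. Qed.

Lemma dotv_sum I (s : seq I) (p : pred I) t (x : I -> 'rV[R]_N) :
  dotv t (\sum_(i <- s | p i) x i) = \sum_(i <- s | p i) dotv t (x i).
Proof.
rewrite /dotv exchange_big/=; apply: eq_bigr => i _.
by rewrite summxE mulr_sumr.
Qed.

End row_vectors.

(** The summands are [t_i Z_i]. The residual of [t_i Z_i] at [s] is [t_i] times that of [Z_i] at
    [s t_i], hence 0, so [fourier_gaussian_dist] applies with both constants 0. *)
Lemma standard_normal_fourier d (T : measurableType d) (R : realType)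
    (P : probability T R) (N : nat) (Z : {RV P >-> 'rV[R]_N}) (t : 'rV[R]_N) (th : R) :
  standard_normal Z ->
  Ex P (fun w => cos (dotv t (Z w) + th)) =
    cos th * expR (- (2^-1 * enorm t ^+ 2)).
Proof.
move=> [iZ NZ].
have mZ i : measurable_fun setT (fun w => Z w ord0 i).
  exact: measurableT_comp (measurable_coord i) _.
pose G i : {mfun T >-> R} := mfun_Sub (mem_set (mZ i)).
have mY i : measurable_fun setT (fun w => t ord0 i * G i w) by exact: measurable_funM.
pose Y i : {mfun T >-> R} := mfun_Sub (mem_set (mY i)).
have NG i A : measurable A -> P (G i @^-1` A) = normal_prob 0 1 A by exact: NZ.
have IG i := (normal_moment2 (@NG i)).1.
have IG1 i : L1 P (G i) by exact: L1_sqr.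
have EY2 i : Ex P (fun w => Y i w ^+ 2) = t ord0 i ^+ 2.
  have -> : (fun w => Y i w ^+ 2) = (fun w => t ord0 i ^+ 2 * G i w ^+ 2).
    by apply/funext => w; rewrite exprMn.
  by rewrite ExZ// (normal_moment2 (@NG i)).2 mulr1.
have iY : mutually_independent P (fun i => Y i : T -> R).
  apply: (@mutually_independent_comp _ _ _ _ _ _ _ _ _
    (fun i w => Z w ord0 i) (fun i x => t ord0 i * x)) => //.
  by move=> i; exact: measurable_funM.
have IY i : L1 P (Y i) by exact: L1Z.
have := @fourier_gaussian_dist _ _ _ P _ Y iY IY (fun=> 0) 0 th.
rewrite !mul0r big1//.
have -> : \sum_i Ex P (fun w => Y i w ^+ 2) = enorm t ^+ 2.
  by rewrite enorm_sqr; apply: eq_bigr => i _; exact: EY2.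
move=> H; apply/eqP; rewrite -subr_eq0 -normr_le0; apply: H => //.
move=> i s b _; rewrite EY2 mulr0 normr_le0 subr_eq0; apply/eqP.
have -> : (fun w => cos (s * Y i w + b)) = (fun w => cos ((s * t ord0 i) * G i w + b)).
  by apply/funext => w; rewrite mulrA.
have -> : (fun w => Y i w * sin (s * Y i w + b)) =
    (fun w => t ord0 i * (G i w * sin ((s * t ord0 i) * G i w + b))).
  by apply/funext => w; rewrite !mulrA.
rewrite ExZ; last exact: L1_mul_sin_affine.
by rewrite -(normal_stein_sin (@NG i)); ring.
Qed.

(** * Square-integrable arrays *)

Section square_integrable_sums.
Context d (T : measurableType d) (R : realType) (P : probability T R).

(** The integral is the difference of those of the positive and negative parts; it is finite only if
    both are. *)
Lemma L1_integral_fin_num (f : T -> R) : measurable_fun setT f ->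
  (\int[P]_w (f w)%:E)%E \is a fin_num -> L1 P f.
Proof.
move=> mf fin; apply/integrableP; split; first exact/measurable_EFinP.
move: fin; rewrite integralE.
rewrite -[X in (integral _ _ X < _)%E]/(abse \o (EFin \o f)) fune_abse.
rewrite ge0_integralD//; last 2 first.
- by apply: measurable_funepos; exact/measurable_EFinP.
- by apply: measurable_funeneg; exact/measurable_EFinP.
have : (0 <= \int[P]_x (EFin \o f)^\+ x)%E by exact: integral_ge0.
have : (0 <= \int[P]_x (EFin \o f)^\- x)%E by exact: integral_ge0.
by move: (integral _ _ _) (integral _ _ _) => [b| |] [a| |]//= _ _ _; rewrite ltry.
Qed.

Lemma indep_sqr_sum_L1 (U V : {mfun T >-> R}) : indep P U V ->
  L1 P (fun w => (U w + V w) ^+ 2) -> L1 P (fun w => U w ^+ 2).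
Proof.
move=> UV IS.
(* E[U^2] E[g V] = E[U^2 g V], where U^2 g V <= 2 (U + V)^2 + 2 and E[g V] > 0. *)
pose g (x : R) := (1 + x ^+ 2)^-1.
have g0 x : 0 < g x by rewrite invr_gt0 ltr_pwDl// sqr_ge0.
have mg : measurable_fun setT g.
  apply: continuous_measurable_fun => x; apply: cvgV.
    by rewrite gt_eqF// ltr_pwDl// sqr_ge0.
  by apply: cvgD; [exact: cvg_cst|exact: exprn_continuous].
have mU2 : measurable_fun setT (fun x : R => x ^+ 2) by exact: measurable_funX.
have mgV : measurable_fun setT (fun w => g (V w)) by exact: measurableT_comp.
have IUg : L1 P (fun w => U w ^+ 2 * g (V w)).
  apply: (le_L1 (g := fun w => 2 * (U w + V w) ^+ 2 + 2)).
  - by apply: measurable_funM => //; exact: measurable_funX.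
  - move=> w; rewrite ger0_norm; last by apply: mulr_ge0; [exact: sqr_ge0|exact/ltW/g0].
    rewrite ler_pdivrMr ?ltr_pwDl ?sqr_ge0//.
    (* [(U + 2 V)^2 >= 0] amounts to [U^2 <= 2 (U + V)^2 + 2 V^2]. *)
    have := sqr_ge0 (U w + 2 * V w); have := sqr_ge0 (V w).
    have := mulr_ge0 (sqr_ge0 (U w + V w)) (sqr_ge0 (V w)).
    rewrite !sqrrD; lra.
  - by apply: L1D; [exact: L1Z|exact: L1_cst].
have := indep_ge0_integralM UV mU2 mg (fun x => sqr_ge0 x) (fun x => ltW (g0 x)).
(* If the integral were 0, the positive function [g V] would vanish off a null set, which would then
   be the whole space. *)
have cg : (0 < \int[P]_w (g (V w))%:E)%E.
  rewrite lt0e integral_ge0 ?andbT; last by move=> w _; rewrite lee_fin ltW.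
  apply/eqP => ig0.
  have : (\int[P]_w `|(g (V w))%:E| = 0)%E.
    by under eq_integral do rewrite /= (gtr0_norm (g0 _)).
  move=> /(ae_eq_integral_abs P measurableT (proj2 (measurable_EFinP _ _) mgV)).
  move=> [N [mN N0 sub]].
  have NT : N = setT.
    apply/seteqP; split => // w _; apply: sub => /= /(_ I) [gV0].
    by have := g0 (V w); rewrite gV0 ltxx.
  by move: N0; rewrite NT => /(etrans (esym (probability_setT P))) /eqP; rewrite onee_eq0.
have : (\int[P]_w (U w ^+ 2 * g (V w))%:E < +oo)%E by exact: integrable_lty.
move=> fin e; apply: L1_ge0.
- exact: measurable_funX.
- by move=> w; exact: sqr_ge0.
rewrite ltey; apply/eqP => infty; move: fin; rewrite e infty gt0_mulye//.
Qed.

Variables (I : finType) (Y : I -> {mfun T >-> R}).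
Hypothesis iY : mutually_independent P (fun i => Y i : T -> R).
Hypothesis IY2 : forall i, L1 P (fun w => Y i w ^+ 2).
Hypothesis EY : forall i, Ex P (Y i) = 0.

(** Each [Y i] is centred and independent of the sum of the others, so the cross terms vanish. *)
Lemma Ex_sum_sqr :
  Ex P (fun w => (\sum_i Y i w) ^+ 2) = \sum_i Ex P (fun w => Y i w ^+ 2).
Proof.
have IY i : L1 P (Y i) by exact: L1_sqr.
have mV i : measurable_fun setT (fun w => \sum_(j | j != i) Y j w).
  exact: L1_measurable (L1_sum _ _).
have IV i : L1 P (fun w => \sum_(j | j != i) Y j w) by exact: L1_sum.
have IYV i : L1 P (fun w => Y i w * \sum_(j | j != i) Y j w).
  under [X in L1 P X]eq_fun do rewrite big_distrr/=.
  by apply: L1_sum => j _; exact: L1_sqr_mul.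
under [X in Ex P X]eq_fun do rewrite {1}expr2 mulr_suml.
have E i w : Y i w * (\sum_j Y j w) = Y i w ^+ 2 + Y i w * \sum_(j | j != i) Y j w.
  by rewrite (bigD1 i)//= mulrDr -expr2.
rewrite Ex_sum; last first.
  by move=> i; under [X in L1 P X]eq_fun do rewrite E; exact: L1D.
apply: eq_bigr => i _; under [X in Ex P X]eq_fun do rewrite E.
rewrite ExD//; pose V : {mfun T >-> R} := mfun_Sub (mem_set (mV i)).
have YV : indep P (Y i) V by exact: mutually_independent_indep_sum.
have := @indep_ExM _ _ _ P (Y i) V YV id id => /= ->//.
by rewrite EY mul0r addr0.
Qed.

End square_integrable_sums.

(** * Moments of the entries of a standard array *)

Section standard_arrays.
Context d (T : measurableType d) (R : realType) (P : probability T R) (N : nat).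
Variable X : triangular_array P N.

Let measurable_entry n (k : 'I_n) : measurable_fun setT (X k).
Proof. exact: measurable_funPT. Qed.

Definition dotv_entry t n (k : 'I_n) : {mfun T >-> R} :=
  mfun_Sub (mem_set (measurableT_comp (measurable_dotv t) (measurable_entry k))).

Definition coord_entry i n (k : 'I_n) : {mfun T >-> R} :=
  mfun_Sub (mem_set (measurableT_comp (measurable_coord i) (measurable_entry k))).

Hypothesis hX : standard_triangular_array X.

Lemma sta_coord_L1 n (k : 'I_n) i : L1 P (coord_entry i k).
Proof.
apply: L1_integral_fin_num => //.
by have := sta_centered hX k i; rewrite unlock => ->.
Qed.

Lemma sta_coord_mean n (k : 'I_n) i : Ex P (coord_entry i k) = 0.
Proof. by have := sta_centered hX k i; rewrite unlock /Ex /Rintegral => ->. Qed.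

Let row_coord n i w : row_sum X n w ord0 i = \sum_(k < n) coord_entry i k w.
Proof. by rewrite /row_sum summxE. Qed.

Let row_coord_L1 n i : L1 P (fun w => row_sum X n w ord0 i).
Proof.
under [Y in L1 _ Y]eq_fun do rewrite row_coord.
by apply: L1_sum => k _; exact: sta_coord_L1.
Qed.

Let row_coord_mean n i : Ex P (fun w => row_sum X n w ord0 i) = 0.
Proof.
under [Y in Ex _ Y]eq_fun do rewrite row_coord.
by rewrite Ex_sum ?big1// => k *; [exact: sta_coord_mean|exact: sta_coord_L1].
Qed.

Let row_covariance n i j : (0 < n)%N ->
  (\int[P]_w (row_sum X n w ord0 i * row_sum X n w ord0 j)%:E = (i == j)%:R%:E)%E.
Proof.
move=> n0; have := sta_covariance hX n0 i j; rewrite unlock mxE => <-.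
rewrite unlock; apply: eq_integral => w _ /=.
have E0 l : fine (\int[P]_w (row_sum X n w ord0 l)%:E) = 0 by exact: row_coord_mean.
by rewrite !E0 !fctE /= !subr0.
Qed.

(** The covariance condition bounds second moments of row sums only; splitting the row into one
    entry and the independent rest passes finiteness to the entry. *)
Lemma sta_coord_sqr_L1 n (k : 'I_n) i : L1 P (fun w => coord_entry i k w ^+ 2).
Proof.
have n0 : (0 < n)%N by exact: leq_ltn_trans (ltn_ord k).
have mV : measurable_fun setT (fun w => \sum_(j < n | j != k) coord_entry i j w).
  by apply: L1_measurable (L1_sum _ _) => j _; exact: sta_coord_L1.
pose V : {mfun T >-> R} := mfun_Sub (mem_set mV).
apply: (@indep_sqr_sum_L1 _ _ _ P (coord_entry i k) V).
  apply: (@mutually_independent_indep_sum _ _ _ P 'I_n (coord_entry i (n := n))).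
  apply: (@mutually_independent_comp _ _ _ _ _ _ _ P 'I_n (fun j => X j)
    (fun _ x => x ord0 i)) => //; first by move=> _; exact: measurable_coord.
  exact: sta_independent hX n.
have -> : (fun w => (coord_entry i k w + V w) ^+ 2) =
    (fun w => row_sum X n w ord0 i * row_sum X n w ord0 i).
  by apply/funext => w; rewrite row_coord [in RHS](bigD1 k)//= expr2.
apply: L1_ge0.
- by apply: measurable_funM; exact: L1_measurable.
- by move=> w; rewrite -expr2 sqr_ge0.
- by rewrite row_covariance// ltry.
Qed.

Lemma sta_enorm_sqr_L1 n (k : 'I_n) : L1 P (fun w => enorm (X k w) ^+ 2).
Proof.
under [Y in L1 _ Y]eq_fun do rewrite enorm_sqr.
by apply: L1_sum => i _; exact: sta_coord_sqr_L1.
Qed.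

Lemma sta_dotv_sqr_L1 t n (k : 'I_n) : L1 P (fun w => dotv_entry t k w ^+ 2).
Proof.
have := L1Z (enorm t ^+ 2) (sta_enorm_sqr_L1 k).
apply: le_L1; first exact: measurable_funX.
by move=> w; rewrite ger0_norm ?sqr_ge0//; exact: dotv_sqr_le.
Qed.

Lemma sta_dotv_mean t n (k : 'I_n) : Ex P (dotv_entry t k) = 0.
Proof.
rewrite (_ : dotv_entry t k = (fun w => \sum_i t ord0 i * coord_entry i k w) :> (T -> R))//.
rewrite Ex_sum; last by move=> i; apply: L1Z; exact: sta_coord_L1.
by rewrite big1// => i _; rewrite ExZ ?sta_coord_mean ?mulr0//; exact: sta_coord_L1.
Qed.

Lemma sta_dotv_independent t n :
  mutually_independent P (fun k : 'I_n => dotv_entry t k : T -> R).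
Proof.
apply: (@mutually_independent_comp _ _ _ _ _ _ _ P 'I_n (fun j => X j)
  (fun _ x => dotv t x)); first by move=> _; exact: measurable_dotv.
exact: sta_independent hX n.
Qed.

Lemma sum_dotv_entry t n w : \sum_(k < n) dotv_entry t k w = dotv t (row_sum X n w).
Proof. by rewrite /row_sum dotv_sum. Qed.

(** By orthogonality the left side is the second moment of [<t, S_n>], the quadratic form of the
    identity covariance at [t]. Row 0 is empty, hence [0 < n]. *)
Lemma sta_dotv_variance t n : (0 < n)%N ->
  \sum_(k < n) Ex P (fun w => dotv_entry t k w ^+ 2) = enorm t ^+ 2.
Proof.
move=> n0; rewrite -Ex_sum_sqr; last 3 first.
- exact: sta_dotv_independent.
- by move=> k; exact: sta_dotv_sqr_L1.
- by move=> k; exact: sta_dotv_mean.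
have IS i j : L1 P (fun w => row_sum X n w ord0 i * row_sum X n w ord0 j).
  apply: L1_integral_fin_num; last by rewrite row_covariance.
  by apply: measurable_funM; exact: L1_measurable.
under [Y in Ex _ Y]eq_fun do rewrite sum_dotv_entry expr2 big_distrlr/=.
rewrite Ex_sum; last first.
  move=> i; apply: L1_sum => j _.
  under [Y in L1 _ Y]eq_fun do rewrite mulrACA.
  exact: L1Z.
rewrite enorm_sqr; apply: eq_bigr => i _.
under [Y in Ex _ Y]eq_fun do under eq_bigr do rewrite mulrACA.
rewrite Ex_sum; last by move=> j; exact: L1Z.
rewrite (bigD1 i)//= big1 ?addr0; last first.
  move=> j ji; rewrite ExZ// /Ex /Rintegral row_covariance//.
  by rewrite eq_sym (negPf ji) mulr0.
by rewrite ExZ// /Ex /Rintegral row_covariance// eqxx mulr1 expr2.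
Qed.

End standard_arrays.

(** * Fourier distance and the Lindeberg sums *)

(** The angle is minus the argument of [u + i v]. It turns a modulus into a real expression at a
    single phase. *)
Lemma polar_angle (R : realType) (u v : R) :
  exists th, Num.sqrt (u ^+ 2 + v ^+ 2) = cos th * u - sin th * v.
Proof.
set r := Num.sqrt _.
have r2 : r ^+ 2 = u ^+ 2 + v ^+ 2 by rewrite sqr_sqrtr// addr_ge0// sqr_ge0.
have r0 : 0 <= r by exact: sqrtr_ge0.
have [re|rn0] := eqVneq r 0.
  exists 0; rewrite cos0 sin0 mul1r mul0r subr0 re; apply/eqP; rewrite eq_sym.
  by have /eqP := r2; rewrite re expr0n/= eq_sym paddr_eq0 ?sqr_ge0// sqrf_eq0 => /andP[].
have rp : 0 < r by rewrite lt_def rn0.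
have c1 : -1 <= u / r <= 1.
  rewrite -ler_norml normrM normfV (ger0_norm r0) ler_pdivrMr// mul1r.
  by rewrite -[leRHS]ger0_norm// -ler_sqr ?nnegrE// !real_normK ?num_real// r2 lerDl sqr_ge0.
have s2 : Num.sqrt (1 - (u / r) ^+ 2) = `|v| / r.
  have -> : 1 - (u / r) ^+ 2 = (`|v| / r) ^+ 2.
    rewrite !exprMn exprVn real_normK ?num_real//.
    have -> : v ^+ 2 = r ^+ 2 - u ^+ 2 by rewrite r2; ring.
    by field.
  by rewrite sqrtr_sqr ger0_norm// divr_ge0.
(* [acos] has nonnegative sine, so the sign of [v] decides between the two angles of cosine
   [u / r]. *)
exists (if 0 <= v then - acos (u / r) else acos (u / r)).
have -> : cos (if 0 <= v then - acos (u / r) else acos (u / r)) = u / r.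
  by case: ifP => _; rewrite ?cosN acosK// in_itv.
have -> : sin (if 0 <= v then - acos (u / r) else acos (u / r)) = - (v / r).
  case: ifPn => [v0|]; rewrite ?sinN sin_acos// s2; first by rewrite ger0_norm.
  by rewrite -ltNge => v0; rewrite ltr0_norm// mulNr.
rewrite mulNr opprK.
have -> : u / r * u + v / r * v = r ^+ 2 / r by rewrite r2; field.
by field.
Qed.

Section fourier_transform.
Context d (T : measurableType d) (R : realType) (P : probability T R) (N : nat).
Implicit Types (H : T -> 'rV[R]_N) (t : 'rV[R]_N).
Local Open Scope complex_scope.

Lemma fourierE H t : measurable_fun setT (fun w => dotv t (H w)) ->
  fourier P H t = Ex P (fun w => cos (dotv t (H w)))
                  +i* (- Ex P (fun w => sin (dotv t (H w)))).
Proof.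
move=> mH; rewrite /fourier /expectationC.
have E x : expC (- 'i * x%:C) = cos x +i* (- sin x) :> R[i].
  rewrite /expC /=; simpc.
  by rewrite expR0 !mul1r cosN sinN.
rewrite unlock; congr (fine _ +i* _).
  by apply: eq_integral => w _; rewrite E.
transitivity (Ex P (fun w => -1 * sin (1 * dotv t (H w) + 0))).
  by congr fine; apply: eq_integral => w _; rewrite E/= mulN1r mul1r addr0.
rewrite ExZ; last exact: L1_sin_affine.
by rewrite mulN1r; congr (- Ex _ _); apply/funext => w; rewrite mul1r addr0.
Qed.

End fourier_transform.

(** At the angle given by [polar_angle], the modulus of the complex difference is a difference of
    expectations of phase-shifted cosines. *)
Lemma fourier_dist_le d d' (T : measurableType d) (T' : measurableType d')
    (R : realType) (P : probability T R) (P' : probability T' R) (N : nat)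
    (H : T -> 'rV[R]_N) (Z : T' -> 'rV[R]_N) (t : 'rV[R]_N) (m : R) :
  measurable_fun setT (fun w => dotv t (H w)) ->
  measurable_fun setT (fun w => dotv t (Z w)) ->
  (forall th, `|Ex P (fun w => cos (dotv t (H w) + th))
                - Ex P' (fun w => cos (dotv t (Z w) + th))| <= m) ->
  Normc.normc (fourier P' Z t - fourier P H t) <= m.
Proof.
move=> mH mZ Hm; rewrite !fourierE//.
have E d0 (T0 : measurableType d0) (P0 : probability T0 R) (f : T0 -> R) th :
    measurable_fun setT f ->
    Ex P0 (fun w => cos (f w + th)) =
    cos th * Ex P0 (fun w => cos (f w)) - sin th * Ex P0 (fun w => sin (f w)).
  move=> mf.
  have Ic : L1 P0 (fun w => cos (f w)).
    have := @L1_cos_affine _ _ _ P0 _ 1 0 mf.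
    by under [X in L1 _ X -> _]eq_fun do rewrite mul1r addr0.
  have Is : L1 P0 (fun w => sin (f w)).
    have := @L1_sin_affine _ _ _ P0 _ 1 0 mf.
    by under [X in L1 _ X -> _]eq_fun do rewrite mul1r addr0.
  rewrite -!ExZ// -ExB; do ?exact: L1Z.
  by congr Ex; apply/funext => w; rewrite cosD; ring.
set u := Ex P (fun w => cos (dotv t (H w))) - Ex P' (fun w => cos (dotv t (Z w))).
set v := Ex P (fun w => sin (dotv t (H w))) - Ex P' (fun w => sin (dotv t (Z w))).
have [th r] := polar_angle u v.
rewrite /= (_ : _ + _ = u ^+ 2 + v ^+ 2); last by rewrite /u /v; ring.
rewrite r (le_trans (ler_norm _))//; have := Hm th; rewrite !E//.
by congr (`|_| <= _); rewrite /u /v; ring.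
Qed.

(** A limit superior is the limit of the tail suprema, so the inequality passes through these.
    Nonnegativity of [a] and [b] keeps the extended sums defined, and the first index is irrelevant
    to the limit. *)
Lemma le_limn_esup_comb (R : realType) (d a b : (\bar R)^nat) (c e : R) :
  0 <= c -> (forall n, (0 <= a n)%E) -> (forall n, (0 <= b n)%E) ->
  (forall n, (0 < n)%N -> (d n <= c%:E * (2%:E * (a n + b n) + e%:E))%E) ->
  (limn_esup d <= c%:E * (2%:E * (limn_esup a + limn_esup b) + e%:E))%E.
Proof.
move=> c0 a0 b0 dab; rewrite !limn_esup_lim.
have sup0 (u : (\bar R)^nat) n : (forall n, 0 <= u n)%E -> (0 <= esups u n)%E.
  by move=> u0; apply: (le_trans (u0 n)); apply: ereal_sup_ubound; exists n => /=.
have lim0 (u : (\bar R)^nat) : (forall n, 0 <= u n)%E -> (0 <= limn (esups u))%E.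
  by move=> u0; apply: lime_ge; [exact: is_cvg_esups|apply: nearW => n; exact: sup0].
have cva := @is_cvg_esups R a; have cvb := @is_cvg_esups R b.
have cv : (c%:E * (2%:E * (esups a n + esups b n) + e%:E))%E @[n --> \oo] -->
    (c%:E * (2%:E * (limn (esups a) + limn (esups b)) + e%:E))%E.
  apply: cvgeZl => //; apply: cvgeD; [exact: fin_num_adde_defl| |exact: cvg_cst].
  by apply: cvgeZl => //; apply: cvgeD => //; apply: ge0_adde_def; rewrite inE lim0.
rewrite -(cvg_lim _ cv)//; apply: lee_lim.
- exact: is_cvg_esups.
- by apply/cvg_ex; eexists; exact: cv.
- near=> n; apply: ge_ereal_sup => _ [k /= nk <-].
  have n0 : (0 < n)%N by near: n; exact: nbhs_infty_gt.
  rewrite (le_trans (dab _ (leq_trans n0 nk)))// lee_wpmul2l ?lee_fin// leeD2r//.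
  rewrite lee_wpmul2l ?lee_fin//; apply: leeD; apply: ereal_sup_ubound; exists k => //.
Unshelve. all: end_near. Qed.

(** * The Lindeberg bound for a single row *)

Section lindeberg_bound.
Context d d' (T : measurableType d) (T' : measurableType d') (R : realType).
Context (P : probability T R) (P' : probability T' R) (N : nat).

Lemma expectation_onE (f : T -> R) (A : set T) : measurable A -> L1 P f ->
  expectation_on P f A = (Ex P (fun w => f w * \1_A w))%:E.
Proof.
move=> mA If; rewrite EFin_Ex; last exact: L1_mul_indic.
by rewrite /expectation_on unlock.
Qed.

Lemma measurable_tail (H : {mfun T >-> 'rV[R]_N}) t :
  measurable [set w | 1 < `|dotv (H w) t|].
Proof.
rewrite -[X in measurable X]setTI; apply: (@measurable_fun_ltr _ _ _ setT (fun=> 1)) => //.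
apply: measurableT_comp => //.
under eq_fun do rewrite dotvC.
by apply: measurableT_comp; [exact: measurable_dotv|exact: measurable_funPT].
Qed.

(** Events about one entry are generators of the sigma-algebra on arrays, so equality of laws and
    independence specialise to that entry. *)
Lemma independent_copy_entry (X X0 : triangular_array P N) n (k : 'I_n) :
  independent_copy X X0 ->
  indep P (X n k) (X0 n k) /\
  forall B, measurable B -> P (X0 n k @^-1` B) = P (X n k @^-1` B).
Proof.
move=> [law ind].
have am (B : set 'rV[R]_N) : measurable B ->
    array_measurable ((fun x => x n k) @^-1` B).
  by move=> mB; apply: sub_sigma_algebra; exists n, k, B.
split=> [A B mA mB|B mB].
  have := ind _ _ (am A mA) (am B mB).
  by rewrite [in P (sample_array X0 @^-1` _)]law; last exact: am.
exact: law (am B mB).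
Qed.

Variables (X X0 : triangular_array P N).
Hypotheses (hX : standard_triangular_array X) (hX0 : independent_copy X X0).

(** The copy has the same tail probability as [X k] and is independent of it, so the product merges
    into one expectation, a summand of the second Lindeberg sum. *)
Lemma sta_copy_ExM t n (k : 'I_n) :
  Ex P (fun w => enorm (X k w) ^+ 2) * Ex P \1_[set w | 1 < `|dotv (X k w) t|] =
  Ex P (fun w => enorm (X k w) ^+ 2 * \1_[set w | 1 < `|dotv (X0 k w) t|] w).
Proof.
have [XX0 law] := independent_copy_entry k hX0.
have IX := sta_enorm_sqr_L1 hX k.
have mE : measurable_fun setT (fun x : 'rV[R]_N => enorm x ^+ 2).
  under eq_fun do rewrite enorm_sqr.
  by apply: measurable_sum => i; apply: measurable_funX; exact: measurable_coord.
have mD : measurable_fun setT (fun x : 'rV[R]_N => dotv x t).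
  by under eq_fun do rewrite dotvC; exact: measurable_dotv.
have mU : measurable_fun setT (fun w => enorm (X k w) ^+ 2).
  exact: measurableT_comp mE (measurable_funPT (X k)).
have mV : measurable_fun setT (fun w => dotv (X0 k w) t).
  exact: measurableT_comp mD (measurable_funPT (X0 k)).
pose U : {mfun T >-> R} := mfun_Sub (mem_set mU).
pose V : {mfun T >-> R} := mfun_Sub (mem_set mV).
have UV : indep P U V by exact: indep_comp mE mD XX0.
pose B : set R := [set x | 1 < `|x|].
have mB : measurable B.
  by rewrite -[B]setTI; apply: (@measurable_fun_ltr _ _ _ setT (fun=> 1)).
have -> : Ex P \1_[set w | 1 < `|dotv (X k w) t|] = Ex P (fun w => \1_B (V w)).
  rewrite Ex_indic; last exact: measurable_tail.
  rewrite -[RHS]/(Ex P \1_(V @^-1` B)) Ex_indic; last exact: measurable_tail.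
  have mDB : measurable ((fun x : 'rV[R]_N => dotv x t) @^-1` B).
    by rewrite -[X in measurable X]setTI; exact: mD.
  by have := law _ mDB => <-.
symmetry; apply: (indep_ExM (f := id) UV) => //.
exact: (@L1_indic _ _ _ P (V @^-1` B) (measurable_tail (X0 k) t)).
Qed.

(** The Lindeberg sum of one row as a real number; the square is always that of [X], and only the
    tail event depends on [H]. *)
Definition lindeberg_tail (H : triangular_array P N) t n : R :=
  \sum_(k < n) Ex P (fun w =>
    enorm (X k w) ^+ 2 * \1_[set w | 1 < `|dotv (H n k w) t|] w).

(** [fourier_gaussian_dist] with the truncated residual bounds: [<t, X_k>^2 <= |t|^2 |X_k|^2] makes
    their sum a multiple of [|t|^2], the variance of the projected row sum. *)
Lemma row_fourier_dist_le (Z : {RV P' >-> 'rV[R]_N}) t n (eps : R) :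
  standard_normal Z -> (0 < n)%N -> 0 < eps ->
  Normc.normc (fourier P' Z t - fourier P (row_sum X n) t) <=
  (2 * (lindeberg_tail X (eps^-1 *: t) n + lindeberg_tail X0 (eps^-1 *: t) n) +
   2 * eps) * (1 - expR (- (2^-1 * enorm t ^+ 2))).
Proof.
move=> hZ n0 eps0; pose Y k := dotv_entry X t (n := n) k.
have mW : measurable_fun setT (fun w => dotv t (row_sum X n w)).
  under eq_fun do rewrite -sum_dotv_entry.
  by apply: measurable_sum => k; exact: measurable_funPT.
apply: fourier_dist_le => //.
  exact: measurableT_comp (measurable_dotv t) (measurable_funPT Z).
move=> th; rewrite standard_normal_fourier// -(sta_dotv_variance hX t n0).
have IY2 k : L1 P (fun w => Y k w ^+ 2) by exact: sta_dotv_sqr_L1.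
have IY k : L1 P (Y k) by exact: L1_sqr.
under [V in `|Ex _ V - _|]eq_fun do rewrite -sum_dotv_entry.
pose A (H : triangular_array P N) k := [set w | 1 < `|dotv (H n k w) (eps^-1 *: t)|].
(* Cutting [<t, X_k>] at [eps] is cutting at 1 for the rescaled vector [t / eps]. *)
have AE k : [set w | eps < `|Y k w|] = A X k.
  have tailE w : (1 < `|dotv (X k w) (eps^-1 *: t)|) = (eps < `|Y k w|).
    rewrite dotvZr dotvC normrM gtr0_norm ?invr_gt0// mulrC.
    by rewrite ltr_pdivlMr// mul1r.
  by apply/funext => w; rewrite /A/= tailE.
have mA H k : measurable (A H k) by exact: measurable_tail.
apply: (@fourier_gaussian_dist _ _ _ P _ Y (sta_dotv_independent hX t (n:=n)) IY
  (fun k => 2 * Ex P (fun w => Y k w ^+ 2 * \1_(A X k) w) +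
    2 * Ex P (fun w => Y k w ^+ 2) * Ex P \1_(A X k) +
    2 * eps * Ex P (fun w => Y k w ^+ 2))
  (2 * (lindeberg_tail X (eps^-1 *: t) n + lindeberg_tail X0 (eps^-1 *: t) n) + 2 * eps)
  th).
  move=> k s b s01; rewrite -AE; apply: stein_residual_truncated => //.
  exact: sta_dotv_mean.
rewrite (sta_dotv_variance hX t n0) !big_split/= -[X in _ + X]mulr_sumr.
rewrite (sta_dotv_variance hX t n0) -[X in X + _ + _]mulr_sumr.
have Y2 k w : Y k w ^+ 2 <= enorm t ^+ 2 * enorm (X k w) ^+ 2 by exact: dotv_sqr_le.
have IX (k : 'I_n) := sta_enorm_sqr_L1 hX k.
have A01 H k w : 0 <= \1_(A H k) w :> R by rewrite indicE.
have tailX : \sum_(k < n) Ex P (fun w => Y k w ^+ 2 * \1_(A X k) w) <=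
    enorm t ^+ 2 * lindeberg_tail X (eps^-1 *: t) n.
  rewrite mulr_sumr; apply: ler_sum => k _.
  rewrite -ExZ; last exact: (L1_mul_indic (mA X k) (IX k)).
  apply: le_Ex; first exact: (L1_mul_indic (mA X k) (IY2 k)).
    by apply: L1Z; exact: (L1_mul_indic (mA X k) (IX k)).
  by move=> w; rewrite mulrA ler_wpM2r.
have tailX0 : \sum_(k < n) (2 * Ex P (fun w => Y k w ^+ 2) * Ex P \1_(A X k)) <=
    2 * (enorm t ^+ 2 * lindeberg_tail X0 (eps^-1 *: t) n).
  rewrite !mulr_sumr; apply: ler_sum => k _; rewrite -mulrA ler_wpM2l//.
  rewrite -sta_copy_ExM mulrA ler_wpM2r//.
    by apply: Rintegral_ge0 => w _; exact: A01.
  by rewrite -ExZ//; apply: le_Ex => //; exact: L1Z.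
by move: tailX tailX0; lra.
Qed.

End lindeberg_bound.

(** * Passage to the limit superior and to the supremum over [t] *)

Theorem theorem2p5 (R : realType) (d d' : measure_display)
    (T : measurableType d) (T' : measurableType d')
    (P : probability T R) (P' : probability T' R)
    (N : nat) (hN : (1 <= N)%N)
    (Z : {RV P' >-> 'rV[R]_N}) (hZ : standard_normal Z)
    (X : triangular_array P N) (hX : standard_triangular_array X)
    (X0 : triangular_array P N) (hX0 : independent_copy X X0) :
  (limit_op P P' (row_sum X) Z <= 2%:E * (lindeberg X X + lindeberg X X0))%E /\
  (forall t : 'rV[R]_N,
     (limsup_fourier_dist P P' (row_sum X) Z t
      <= (2 * (1 - expR (- (2^-1 * enorm t ^+ 2))))%:E
         * (lindeberg X X + lindeberg X X0))%E).
Proof.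
have term0 (H : triangular_array P N) t n (k : 'I_n) :
    (0 <= expectation_on P (fun w => enorm (X n k w) ^+ 2)%R
        [set w | (1 < `|dotv (H n k w) t|)%R])%E.
  rewrite /expectation_on unlock; apply: integral_ge0 => w _.
  by rewrite lee_fin mulr_ge0 ?sqr_ge0// indicE.
have lim_le (H : triangular_array P N) t :
    (limn_esup (fun n => \sum_(k < n)
      expectation_on P (fun w => enorm (X n k w) ^+ 2)%R
        [set w | (1 < `|dotv (H n k w) t|)%R])%E <= lindeberg X H)%E.
  by apply: ereal_sup_ubound; exists t.
have lin0 H : (0 <= lindeberg X H)%E.
  apply: le_trans (lim_le H 0); apply: limf_esup_ge0 => [|n].
    exact: filter_not_empty.
  by apply: sume_ge0 => k _; exact: term0.
have main t : (limsup_fourier_dist P P' (row_sum X) Z t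
      <= (2 * (1 - expR (- (2^-1 * enorm t ^+ 2))))%:E
         * (lindeberg X X + lindeberg X X0))%E.
  set c := 1 - expR _.
  have c0 : 0 <= c by rewrite subr_ge0 expR_le1 oppr_le0 mulr_ge0// sqr_ge0.
  have c1 : c <= 1 by rewrite gerBl expR_ge0.
  apply/lee_addgt0Pr => e e0.
  (* The cutting level is [e / 2], so that the error [2 eps] of the row estimate is [e]. *)
  have e20 : 0 < e / 2 by rewrite divr_gt0.
  pose tail (H : triangular_array P N) n := (\sum_(k < n)
      expectation_on P (fun w => enorm (X n k w) ^+ 2)%R
        [set w | (1 < `|dotv (H n k w) ((e / 2)^-1 *: t)|)%R])%E.
  have tail0 H n : (0 <= tail H n)%E by apply: sume_ge0 => k _; exact: term0.
  apply: (@le_trans _ _ (c%:E * (2%:E * (limn_esup (tail X) + limn_esup (tail X0)) + e%:E))%E).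
    apply: le_limn_esup_comb => // n n0.
    have tailE H : tail H n = (lindeberg_tail X H ((e / 2)^-1 *: t) n)%:E.
      rewrite -sumEFin; apply: eq_bigr => k _; rewrite expectation_onE//.
        exact: measurable_tail.
      exact: sta_enorm_sqr_L1.
    rewrite !tailE -[leRHS]/((c * (2 * (_ + _) + e))%:E) lee_fin mulrC.
    have := row_fourier_dist_le hX hX0 t hZ n0 e20.
    by rewrite (_ : 2 * (e / 2) = e); last by field.
  rewrite ge0_muleDr; last 2 first.
  - by rewrite mule_ge0// adde_ge0// limf_esup_ge0.
  - by rewrite lee_fin ltW.
  (* The vector [t / eps] is one of those over which [lindeberg] takes its supremum, so the cutting
     level disappears from the bound; the error is at most [e] as [c <= 1]. *)
  apply: leeD.
    rewrite [2 * c]mulrC EFinM -muleA; apply: lee_wpmul2l; first by rewrite lee_fin.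
    by apply: lee_wpmul2l; [rewrite lee_fin|apply: leeD; exact: lim_le].
  by rewrite -EFinM lee_fin ler_piMl// ltW.
split=> //; apply: ge_ereal_sup => _ [t _ <-]; apply: (le_trans (main t)).
(* The factor [1 - exp (- |t|^2 / 2)] is at most 1, so the bound is uniform in [t]. *)
rewrite lee_wpmul2r ?adde_ge0// lee_fin ler_piMr// gerBl expR_ge0.
Qed.
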